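(* Let $\mathcal{G}_1=\mathcal{D}(\mathcal{H}_1,x)$ be the diagram group with base $x$ of the directed $2$-complex $\mathcal{H}_1$ having one vertex, one edge $x$ and two positive $2$-cells, of the forms $x^2=x$ and $x=x$. Let $\Phi$ be the set of all continuous piecewise linear functions $h$ from $[0,1]$ into $[0,1]$ with finitely many singularity points (breakpoints of the derivative), such that $(0)h$, $(1)h$ and all the singularity points of $h$ are dyadic rational and all slopes of $h$ are of the form $2^k$, $k\in\mathbb{Z}$. Let $\mathcal{A}$ be the partially commutative group generated by symbols $\alpha_h$, $h\in\Phi$, in which two generators $\alpha_{h_1}$, $\alpha_{h_2}$ commute if and only if the interiors of the images of $h_1$ and $h_2$ are disjoint (i.e. the defining relations are $[\alpha_{h_1},\alpha_{h_2}]=1$ for all $h_1,h_2\in\Phi$ whose images have disjoint interiors). Let $F$ be R. Thompson's group, viewed as a group of piecewise linear functions and hence as a subset of $\Phi$. Then $\mathcal{G}_1$ is isomorphic to the semidirect product of the (normal) subgroup $\mathcal{A}$ and $F$, where $F$ acts on $\mathcal{A}$ by $g^{-1}\alpha_h g=\alpha_{hg}$ for all $h\in\Phi$, $g\in F$.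
   Context: Functions are written to the right of their arguments: $(t)h$ is the value of $h$ at $t$, and $hg$ denotes the composition ''first $h$, then $g$''. R. Thompson's group $F$ is the group, under composition, of all increasing continuous piecewise linear functions from $[0,1]$ onto itself whose singularities occur only at finitely many dyadic rational points and all of whose slopes are integer powers of $2$. $[a,b]=a^{-1}b^{-1}ab$. A directed $2$-complex $\mathcal{K}$ consists of: a directed graph; a set of $2$-cells; for each $2$-cell $f$, two nonempty directed paths $\lceil f\rceil$ (top) and $\lfloor f\rfloor$ (bottom) in the graph with the same initial vertex and the same terminal vertex; and a fixed-point-free involution $f\mapsto f^{-1}$ on $2$-cells with $\lceil f^{-1}\rceil=\lfloor f\rfloor$, $\lfloor f^{-1}\rfloor=\lceil f\rceil$. One $2$-cell in each pair $\{f,f^{-1}\}$ is called positive; a positive $2$-cell with top $u$ and bottom $v$ is said to have the form $u=v$. A $1$-path is a (possibly empty) directed path in the graph. The Squier complex $\mathrm{Sq}(\mathcal{K})$ is the $2$-dimensional cell complex whose vertices are the nonempty $1$-paths; whose edges are the triples $(p,f,q)$, with $p,q$ $1$-paths and $f$ a $2$-cell such that $p\lceil f\rceil q$ is a $1$-path, going from $p\lceil f\rceil q$ to $p\lfloor f\rfloor q$, with $(p,f,q)^{-1}=(p,f^{-1},q)$; and which has, for every $(p,f,q,g,r)$ with $f,g$ $2$-cells and $p\lceil f\rceil q\lceil g\rceil r$ a $1$-path, a $2$-cell attached along the loop $(p,f,q\lceil g\rceil r)\,(p\lfloor f\rfloor q,g,r)\,(p,f,q\lfloor g\rfloor r)^{-1}\,(p\lceil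 f\rceil q,g,r)^{-1}$. For a nonempty $1$-path $w$, the diagram group is $\mathcal{D}(\mathcal{K},w)=\pi_1(\mathrm{Sq}(\mathcal{K}),w)$. *)

(* Defs.v *)
From HB Require Import structures.
From mathcomp Require Import all_boot all_order all_algebra.
From mathcomp Require Import interval_inference.
From mathcomp Require Import boolp classical_sets reals topology normedtype.
From Stdlib Require Import Relation_Operators.
From mathcomp Require Import ring lra.
Set Implicit Arguments.
Unset Strict Implicit.
Unset Printing Implicit Defensive.
Import Order.TTheory GRing.Theory Num.Theory.
Import numFieldNormedType.Exports.

(* A group up to an equivalence relation. *)
Record pregroup := Pregroup {
  pg_sort :> choiceType;
  pg_one : pg_sort;
  pg_inv : pg_sort -> pg_sort;
  pg_mul : pg_sort -> pg_sort -> pg_sort;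
  pg_eqv : pg_sort -> pg_sort -> Prop;
  pg_refl : forall x, pg_eqv x x;
  pg_sym : forall x y, pg_eqv x y -> pg_eqv y x;
  pg_trans : forall x y z, pg_eqv x y -> pg_eqv y z -> pg_eqv x z;
  pg_mulP : forall x x' y y', pg_eqv x x' -> pg_eqv y y' ->
    pg_eqv (pg_mul x y) (pg_mul x' y');
  pg_invP : forall x x', pg_eqv x x' -> pg_eqv (pg_inv x) (pg_inv x');
  pg_mulA : forall x y z,
    pg_eqv (pg_mul x (pg_mul y z)) (pg_mul (pg_mul x y) z);
  pg_mul1 : forall x, pg_eqv (pg_mul pg_one x) x;
  pg_1mul : forall x, pg_eqv (pg_mul x pg_one) x;
  pg_mulV : forall x, pg_eqv (pg_mul (pg_inv x) x) pg_one;
  pg_Vmul : forall x, pg_eqv (pg_mul x (pg_inv x)) pg_one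
}.

Section QuotientGroup.
Variable P : pregroup.
Implicit Types x y z : P.

Definition pg_rel : rel P := fun x y => `[< pg_eqv x y >].

Lemma pg_rel_refl : reflexive pg_rel.
Proof. by move=> x; apply/asboolP/pg_refl. Qed.

Lemma pg_rel_sym : symmetric pg_rel.
Proof. by move=> x y; apply/asboolP/asboolP; apply: pg_sym. Qed.

Lemma pg_rel_trans : transitive pg_rel.
Proof.
by move=> y x z /asboolP xy /asboolP yz; apply/asboolP; apply: pg_trans yz.
Qed.

Canonical pg_equiv := EquivRel pg_rel pg_rel_refl pg_rel_sym pg_rel_trans.

Definition quot_group := {eq_quot pg_equiv}%qT.
HB.instance Definition _ := Choice.on quot_group.

Definition qclass x : quot_group := (\pi_{eq_quot pg_equiv} x)%qT.
Definition qrepr (a : quot_group) : P := repr (a : {eq_quot pg_equiv}%qT).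

Lemma qreprK a : qclass (qrepr a) = a.
Proof. exact: reprK. Qed.

Lemma qclassP x y : qclass x = qclass y <-> pg_eqv x y.
Proof.
split=> [/(@eqmodP _ pg_equiv)/asboolP//|xy].
by apply/(@eqmodP _ pg_equiv)/asboolP.
Qed.

Lemma qreprP x : pg_eqv (qrepr (qclass x)) x.
Proof. by apply/qclassP; rewrite qreprK. Qed.

Let qone := qclass (@pg_one P).
Let qinv a := qclass (pg_inv (qrepr a)).
Let qmul a b := qclass (pg_mul (qrepr a) (qrepr b)).

Let qmulE x y : qmul (qclass x) (qclass y) = qclass (pg_mul x y).
Proof. by apply/qclassP/pg_mulP; exact: qreprP. Qed.

Let qinvE x : qinv (qclass x) = qclass (pg_inv x).
Proof. by apply/qclassP/pg_invP; exact: qreprP. Qed.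

Let qmulA : associative qmul.
Proof.
move=> a b c; rewrite -[a]qreprK -[b]qreprK -[c]qreprK !qmulE.
by apply/qclassP; exact: pg_mulA.
Qed.
Let qmul1 : left_id qone qmul.
Proof. by move=> a; rewrite -[a]qreprK qmulE; apply/qclassP/pg_mul1. Qed.
Let q1mul : right_id qone qmul.
Proof. by move=> a; rewrite -[a]qreprK qmulE; apply/qclassP/pg_1mul. Qed.
Let qmulV : left_inverse qone qinv qmul.
Proof. by move=> a; rewrite -[a]qreprK qinvE qmulE; apply/qclassP/pg_mulV. Qed.
Let qVmul : right_inverse qone qinv qmul.
Proof. by move=> a; rewrite -[a]qreprK qinvE qmulE; apply/qclassP/pg_Vmul. Qed.

HB.instance Definition _ :=
  isGroup.Build quot_group qmulA qmul1 q1mul qmulV qVmul.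

Lemma qclassM x y : (qclass x * qclass y)%g = qclass (pg_mul x y).
Proof. exact: qmulE. Qed.

Lemma qclassV x : ((qclass x)^-1)%g = qclass (pg_inv x).
Proof. exact: qinvE. Qed.

Lemma qclass1 : qclass (@pg_one P) = 1%g.
Proof. by []. Qed.

End QuotientGroup.
Section Presentation.
Variables (X : choiceType) (relator : seq (X * bool) -> Prop).

(* The letter (x, true) stands for x and (x, false) for its inverse. *)
Implicit Types u v r : seq (X * bool).

Definition word_inv u := [seq (a.1, ~~ a.2) | a <- rev u].

Variant pres_step : seq (X * bool) -> seq (X * bool) -> Prop :=
| PresCancel u x b v : pres_step (u ++ [:: (x, b); (x, ~~ b)] ++ v) (u ++ v)
| PresRelator u r v : relator r -> pres_step (u ++ r ++ v) (u ++ v).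

Definition pres_eqv := clos_refl_sym_trans _ pres_step.

Lemma word_invK : involutive word_inv.
Proof.
move=> u; rewrite /word_inv -map_rev revK -map_comp -[RHS]map_id.
by apply: eq_map => -[x b] /=; rewrite negbK.
Qed.

Lemma word_inv_cat u v : word_inv (u ++ v) = word_inv v ++ word_inv u.
Proof. by rewrite /word_inv rev_cat map_cat. Qed.

Lemma eqv_sandwich u v w z : pres_eqv w z -> pres_eqv (u ++ w ++ v) (u ++ z ++ v).
Proof.
elim=> [{}w {}z wz|{}w|{}w {}z _|w1 w2 w3 _ IH1 _ IH2]; last 3 first.
- exact: rst_refl.
- exact: rst_sym.
- exact: rst_trans IH1 IH2.
apply: rst_step; case: wz => [a x b c|a r c rr]; rewrite -!catA catA.
  by rewrite [X in pres_step _ X]catA; exact: PresCancel.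
by rewrite [X in pres_step _ X]catA; exact: PresRelator.
Qed.

Lemma eqv_catl u w z : pres_eqv w z -> pres_eqv (u ++ w) (u ++ z).
Proof. by move/(eqv_sandwich u [::]); rewrite !cats0. Qed.

Lemma eqv_cat w w' z z' :
  pres_eqv w w' -> pres_eqv z z' -> pres_eqv (w ++ z) (w' ++ z').
Proof.
move=> ww' zz'; apply: rst_trans (eqv_catl w' zz').
exact: (eqv_sandwich [::] z ww').
Qed.

Lemma eqv_mulV u : pres_eqv (word_inv u ++ u) [::].
Proof.
elim: u => [|[x b] u IHu]; first exact: rst_refl.
apply: rst_trans IHu; rewrite -cat1s word_inv_cat -catA.
rewrite -{2}(cat0s u) -[word_inv [:: (x, b)] ++ _]cat0s.
apply: rst_step => /=.
by rewrite -{2}[b]negbK; exact: (PresCancel (word_inv u) x (~~ b) u).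
Qed.

Lemma eqv_Vmul u : pres_eqv (u ++ word_inv u) [::].
Proof. by have := eqv_mulV (word_inv u); rewrite word_invK. Qed.

Lemma eqv_inv w z : pres_eqv w z -> pres_eqv (word_inv w) (word_inv z).
Proof.
move=> wz; apply: (@rst_trans _ _ _ (word_inv w ++ z ++ word_inv z)).
  by rewrite -{1}[word_inv w]cats0; apply/eqv_catl/rst_sym/eqv_Vmul.
rewrite catA -[X in _ _ X]cat0s; apply: eqv_cat (rst_refl _ _ _).
apply: rst_trans (eqv_mulV w); apply/eqv_catl/rst_sym/wz.
Qed.

Definition presented : pregroup.
Proof.
apply: (@Pregroup (seq (X * bool)) [::] word_inv cat pres_eqv
  (@rst_refl _ _) (@rst_sym _ _) (@rst_trans _ _) (fun _ _ _ _ => @eqv_cat _ _ _ _)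
  eqv_inv _ _ _ eqv_mulV eqv_Vmul) => [x y z|x|x].
- by rewrite catA; exact: rst_refl.
- exact: rst_refl.
- by rewrite cats0; exact: rst_refl.
Defined.

Definition pres_group := quot_group presented.
HB.instance Definition _ := Group.on pres_group.

Definition pres_gen x : pres_group := @qclass presented [:: (x, true)].

End Presentation.

Section PartiallyCommutative.
Variables (X : choiceType) (comm : X -> X -> Prop).

Definition comm_relator (r : seq (X * bool)) :=
  exists x y, comm x y /\ r = [:: (x, false); (y, false); (x, true); (y, true)].

Definition pc_group := pres_group comm_relator.
HB.instance Definition _ := Group.on pc_group.

Definition pc_gen x : pc_group := pres_gen comm_relator x.

End PartiallyCommutative.

Record digraph := Digraph {
  dvert : choiceType;
  dedge : choiceType;
  src : dedge -> dvert;
  tgt : dedge -> dvert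
}.

Section Digraph.
Variable G : digraph.
Implicit Types (x y : dvert G) (s t : seq (dedge G)).

Fixpoint dpath x s y : bool :=
  if s is e :: s' then (src e == x) && dpath (tgt e) s' y else x == y.

(* The word of edges of a possibly empty directed path; the empty word stands
   for the empty path at whichever vertex is determined by the context. *)
Definition is_path s : bool := sorted (fun e f => tgt e == src f) s.

Definition dtgt x s := foldl (fun _ e => tgt e) x s.

Lemma dpath_tgt x s y : dpath x s y -> dtgt x s = y.
Proof. by elim: s x => [|e s IHs] x /= => [/eqP|/andP[_ /IHs]]. Qed.

Lemma dpath_cat x s t y :
  dpath x (s ++ t) y = dpath x s (dtgt x s) && dpath (dtgt x s) t y.
Proof. by elim: s x => [|e s IHs] x /=; rewrite ?eqxx// IHs andbA. Qed.

Lemma dpath_catP x s t y :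
  reflect (exists2 z, dpath x s z & dpath z t y) (dpath x (s ++ t) y).
Proof.
rewrite dpath_cat; apply: (iffP andP) => [[xs ty]|[z xs ty]].
  by exists (dtgt x s).
by rewrite (dpath_tgt xs).
Qed.

Lemma is_path_cons e s : is_path (e :: s) = dpath (src e) (e :: s) (dtgt (src e) (e :: s)).
Proof.
rewrite /is_path /= eqxx /=.
elim: s e => [|f s IHs] e /=; first by rewrite eqxx.
by rewrite IHs eq_sym.
Qed.

Lemma is_pathP s : s != [::] ->
  reflect (exists x y, dpath x s y) (is_path s).
Proof.
case: s => // e s _; rewrite is_path_cons; apply: (iffP idP) => [h|].
  by exists (src e), (dtgt (src e) (e :: s)).
by move=> [x [y h]]; have := h; rewrite -(dpath_tgt h) /= eqxx => /andP[].
Qed.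

End Digraph.

(* A combinatorial 2-dimensional cell complex: a graph with an involution on
   its oriented edges, and 2-cells attached along closed edge paths. *)
Record complex2 := Complex2 {
  skel :> digraph;
  einv : dedge skel -> dedge skel;
  einvK : involutive einv;
  einv_neq : forall e, einv e != e;
  src_einv : forall e, src (einv e) = tgt e;
  face : Type;
  bdry : face -> seq (dedge skel);
  bdry_loop : forall c, exists x, dpath x (bdry c) x
}.

Section FundamentalGroup.
Variables (X : complex2) (w : dvert X).
Local Notation E := (dedge X).
Implicit Types (s t u v : seq E).

Record loop := Loop { loop_seq :> seq E; loopP : dpath w loop_seq w }.
HB.instance Definition _ := [isSub for loop_seq].
HB.instance Definition _ := [Choice of loop by <:].
Implicit Types l m : loop.

(* The fundamental group is the group of edge loops at w modulo insertion and
   deletion of spurs e e^-1 and of boundaries of 2-cells. *)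
Variant homotopy_step l m : Prop :=
| HomotopySpur u e v of l = u ++ [:: e; einv e] ++ v :> seq E
                      & m = u ++ v :> seq E
| HomotopyFace u c v of l = u ++ bdry c ++ v :> seq E & m = u ++ v :> seq E.

Definition homotopic := clos_refl_sym_trans _ homotopy_step.

Lemma tgt_einv (e : E) : tgt (einv e) = src e.
Proof. by rewrite -src_einv einvK. Qed.

Definition path_inv s := [seq einv e | e <- rev s].

Lemma path_inv_cat s t : path_inv (s ++ t) = path_inv t ++ path_inv s.
Proof. by rewrite /path_inv rev_cat map_cat. Qed.

Lemma path_invK : involutive path_inv.
Proof.
by move=> s; rewrite /path_inv -map_rev revK -map_comp map_id_in// => e _ /=;
  rewrite einvK.
Qed.

Lemma dpath_inv x s y : dpath x s y -> dpath y (path_inv s) x.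
Proof.
elim: s x => [|e s IHs] x /=; first by rewrite eq_sym.
move=> /andP[/eqP <- /IHs es]; rewrite -cat1s path_inv_cat.
by apply/dpath_catP; exists (tgt e) => //=; rewrite src_einv tgt_einv !eqxx.
Qed.

Lemma loop_cat_subproof l m : dpath w (l ++ m) w.
Proof. by apply/dpath_catP; exists w; exact: loopP. Qed.

Definition loop_one := @Loop [::] (eqxx w).
Definition loop_inv l := Loop (dpath_inv (loopP l)).
Definition loop_mul l m := Loop (loop_cat_subproof l m).

Lemma hom_cat l l' m m' :
  homotopic l l' -> homotopic m m' -> homotopic (loop_mul l m) (loop_mul l' m').
Proof.
move=> ll' mm'; apply: (@rst_trans _ _ _ (loop_mul l' m)).
  elim: ll' => [a b ab|a|a b _|a b c _ IH1 _ IH2]; last 3 first.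
  - exact: rst_refl.
  - exact: rst_sym.
  - exact: rst_trans IH1 IH2.
  apply: rst_step; case: ab => [u e v|u c v] aE bE.
    by apply: (@HomotopySpur _ _ u e (v ++ m)); rewrite /= ?aE ?bE -!catA.
  by apply: (@HomotopyFace _ _ u c (v ++ m)); rewrite /= ?aE ?bE -!catA.
elim: mm' => [a b ab|a|a b _|a b c _ IH1 _ IH2]; last 3 first.
- exact: rst_refl.
- exact: rst_sym.
- exact: rst_trans IH1 IH2.
apply: rst_step; case: ab => [u e v|u c v] aE bE.
  by apply: (@HomotopySpur _ _ (l' ++ u) e v); rewrite /= ?aE ?bE -!catA.
by apply: (@HomotopyFace _ _ (l' ++ u) c v); rewrite /= ?aE ?bE -!catA.
Qed.

Lemma hom_spur u s v l m :
  l = u ++ s ++ path_inv s ++ v :> seq E -> m = u ++ v :> seq E -> homotopic l m.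
Proof.
elim: s u v l m => [|e s IHs] u v l m /= lE mE.
  by rewrite (_ : l = m); [exact: rst_refl|apply: val_inj; rewrite /= lE mE].
have lE' : l = (u ++ [:: e]) ++ s ++ path_inv s ++ (einv e :: v) :> seq E.
  by rewrite lE -[e :: s]cat1s path_inv_cat -!catA.
have lp : dpath w (u ++ [:: e; einv e] ++ v) w.
  have := loopP m; rewrite mE => /dpath_catP[x ux vx].
  have := loopP l; rewrite lE => /dpath_catP[x' ux'] /andP[/eqP ex' _].
  apply/dpath_catP; exists x => //=.
  by rewrite ex' -(dpath_tgt ux) (dpath_tgt ux') !eqxx src_einv tgt_einv eqxx /=
     ex' -(dpath_tgt ux') (dpath_tgt ux).
apply: (@rst_trans _ _ _ (Loop lp)).
  by apply: (IHs (u ++ [:: e]) (einv e :: v)); rewrite //= -!catA.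
by apply: rst_step; apply: HomotopySpur mE.
Qed.

Lemma hom_Vmul l : homotopic (loop_mul l (loop_inv l)) loop_one.
Proof. by apply: (hom_spur (u := [::]) (v := [::]) (s := l)); rewrite //= cats0. Qed.

Lemma hom_mulV l : homotopic (loop_mul (loop_inv l) l) loop_one.
Proof.
apply: (hom_spur (u := [::]) (v := [::]) (s := path_inv l)) => //=.
by rewrite path_invK cats0.
Qed.

Lemma hom_mulA l m n : loop_mul l (loop_mul m n) = loop_mul (loop_mul l m) n.
Proof. by apply: val_inj; rewrite /= catA. Qed.
Lemma hom_mul1 l : loop_mul loop_one l = l.
Proof. exact: val_inj. Qed.
Lemma hom_1mul l : loop_mul l loop_one = l.
Proof. by apply: val_inj; rewrite /= cats0. Qed.

Lemma hom_inv l m : homotopic l m -> homotopic (loop_inv l) (loop_inv m).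
Proof.
move=> lm; have rr := rst_refl loop homotopy_step.
apply: (@rst_trans _ _ _ (loop_mul (loop_inv l) (loop_mul m (loop_inv m)))).
  rewrite -{1}[loop_inv l]hom_1mul.
  by apply: hom_cat => //; apply/rst_sym/hom_Vmul.
rewrite hom_mulA -{2}[loop_inv m]hom_mul1; apply: hom_cat => //.
by apply: rst_trans (hom_mulV l); apply: hom_cat => //; apply: rst_sym.
Qed.

Definition loops : pregroup.
Proof.
apply: (@Pregroup loop loop_one loop_inv loop_mul homotopic
  (@rst_refl _ _) (@rst_sym _ _) (@rst_trans _ _) (fun _ _ _ _ => @hom_cat _ _ _ _)
  hom_inv _ _ _ hom_mulV hom_Vmul) => [x y z|x|x].
- by rewrite hom_mulA; exact: rst_refl.
- by rewrite hom_mul1; exact: rst_refl.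
- by rewrite hom_1mul; exact: rst_refl.
Defined.

Definition pi1 := quot_group loops.
HB.instance Definition _ := Group.on pi1.

Definition homotopy_class l : pi1 := @qclass loops l.

End FundamentalGroup.
Record dir_complex := DirComplex {
  dgraph :> digraph;
  cell : choiceType;
  top : cell -> seq (dedge dgraph);
  bot : cell -> seq (dedge dgraph);
  top_neq0 : forall f, top f != [::];
  bot_neq0 : forall f, bot f != [::];
  cell_ends : forall f, exists x y, dpath x (top f) y && dpath x (bot f) y;
  cinv : cell -> cell;
  cinvK : involutive cinv;
  cinv_neq : forall f, cinv f != f;
  top_cinv : forall f, top (cinv f) = bot f;
  bot_cinv : forall f, bot (cinv f) = top f;
  positive : pred cell;
  positive_cinv : forall f, positive (cinv f) = ~~ positive f
}.

Section Squier.
Variable K : dir_complex.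
Local Notation E := (dedge K).
Implicit Types (p q r : seq E) (f g : cell K).

Lemma is_path_swap p f q :
  is_path (p ++ top f ++ q) = is_path (p ++ bot f ++ q).
Proof.
have nz u s v : s != [::] -> u ++ s ++ v != [::] :> seq E by case: u; case: s.
have [x [y /andP[xt xb]]] := cell_ends f.
have [t0 b0] := (top_neq0 f, bot_neq0 f).
have same s t : s != [::] -> t != [::] -> dpath x s y -> dpath x t y ->
    is_path (p ++ s ++ q) -> is_path (p ++ t ++ q).
  move=> s0 t0' xs xt' /(is_pathP (nz _ _ _ s0))[a [b]].
  move=> /dpath_catP[c ac] /dpath_catP[d cd db].
  apply/(is_pathP (nz _ _ _ t0')); exists a, b.
  have cx : c = x.
    by move: s0 cd xs; case: (s) => //= e s' _ /andP[/eqP <- _] /andP[/eqP].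
  have dy : d = y by rewrite -(dpath_tgt cd) -(dpath_tgt xs) cx.
  by apply/dpath_catP; exists c => //; apply/dpath_catP; exists d => //;
    rewrite cx dy.
by apply/idP/idP; apply: same.
Qed.

Record sq_vert := SqVert {
  sq_path : seq E;
  sq_vertP : (sq_path != [::]) && is_path sq_path
}.
HB.instance Definition _ := [isSub for sq_path].
HB.instance Definition _ := [Choice of sq_vert by <:].

(* Vertices of empty p and q are not recorded in the triple (p, f, q): they are
   the end points of the nonempty path top f. *)
Record sq_edge := SqEdge {
  sq_triple : seq E * cell K * seq E;
  sq_edgeP : is_path (sq_triple.1.1 ++ top sq_triple.1.2 ++ sq_triple.2)
}.
HB.instance Definition _ := [isSub for sq_triple].
HB.instance Definition _ := [Choice of sq_edge by <:].

Lemma sq_src_subproof (e : sq_edge) : let: (p, f, q) := sq_triple e in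
  (p ++ top f ++ q != [::]) && is_path (p ++ top f ++ q).
Proof.
case: e => -[[p f] q] /= ->; rewrite andbT.
by have := top_neq0 f; case: p => //; case: (top f).
Qed.

Lemma sq_tgt_subproof (e : sq_edge) : let: (p, f, q) := sq_triple e in
  (p ++ bot f ++ q != [::]) && is_path (p ++ bot f ++ q).
Proof.
case: e => -[[p f] q] /=; rewrite is_path_swap => ->; rewrite andbT.
by have := bot_neq0 f; case: p => //; case: (bot f).
Qed.

Lemma sq_inv_subproof (e : sq_edge) : let: (p, f, q) := sq_triple e in
  is_path (p ++ top (cinv f) ++ q).
Proof. by case: e => -[[p f] q] /=; rewrite is_path_swap top_cinv. Qed.

Definition sq_src (e : sq_edge) : sq_vert :=
  let: SqEdge (p, f, q) pfq := e in SqVert (sq_src_subproof (SqEdge pfq)).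
Definition sq_tgt (e : sq_edge) : sq_vert :=
  let: SqEdge (p, f, q) pfq := e in SqVert (sq_tgt_subproof (SqEdge pfq)).
Definition sq_inv (e : sq_edge) : sq_edge :=
  let: SqEdge (p, f, q) pfq := e in
  @SqEdge (p, cinv f, q) (sq_inv_subproof (SqEdge pfq)).

Definition sq_graph := Digraph sq_src sq_tgt.

Lemma sq_invK : involutive sq_inv.
Proof. by move=> [[[p f] q] h]; apply: val_inj; rewrite /= cinvK. Qed.

Lemma sq_inv_neq e : sq_inv e != e.
Proof.
apply/eqP; case: e => -[[p f] q] h /(congr1 (fun e => (sq_triple e).1.2)) /= ff.
by have := cinv_neq f; rewrite ff eqxx.
Qed.

Lemma sq_src_inv e : sq_src (sq_inv e) = sq_tgt e.
Proof. by case: e => -[[p f] q] h; apply: val_inj; rewrite /= top_cinv. Qed.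

Record sq_face := SqFace {
  sqf_p : seq E; sqf_f : cell K; sqf_q : seq E; sqf_g : cell K; sqf_r : seq E;
  sq_faceP : is_path (sqf_p ++ top sqf_f ++ sqf_q ++ top sqf_g ++ sqf_r)
}.

Section Boundary.
Variable c : sq_face.
Let p := sqf_p c. Let f := sqf_f c. Let q := sqf_q c.
Let g := sqf_g c. Let r := sqf_r c.

Lemma sq_side1 : is_path (p ++ top f ++ (q ++ top g ++ r)).
Proof. exact: sq_faceP. Qed.
Lemma sq_side2 : is_path ((p ++ bot f ++ q) ++ top g ++ r).
Proof. by rewrite -!catA -is_path_swap; exact: sq_faceP. Qed.
Lemma sq_side4 : is_path ((p ++ top f ++ q) ++ top g ++ r).
Proof. by rewrite -!catA; exact: sq_faceP. Qed.
Lemma sq_side3 : is_path (p ++ top f ++ (q ++ bot g ++ r)).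
Proof. by have := sq_side4; rewrite is_path_swap -!catA. Qed.

Definition sq_bdry : seq sq_edge :=
  [:: @SqEdge (p, f, q ++ top g ++ r) sq_side1;
      @SqEdge (p ++ bot f ++ q, g, r) sq_side2;
      sq_inv (@SqEdge (p, f, q ++ bot g ++ r) sq_side3);
      sq_inv (@SqEdge (p ++ top f ++ q, g, r) sq_side4)].

End Boundary.

Lemma sq_bdry_loop c : exists x, @dpath sq_graph x (sq_bdry c) x.
Proof.
pose e1 := @SqEdge (_, _, _) (sq_side1 c); exists (sq_src e1).
rewrite /= eqxx /=; do !(apply/andP; split); rewrite -val_eqE /=;
  by rewrite -?catA ?top_cinv ?bot_cinv -?catA.
Qed.

Definition squier := @Complex2 sq_graph sq_inv sq_invK sq_inv_neq sq_src_inv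
  sq_face sq_bdry sq_bdry_loop.

Definition diagram_group (w : sq_vert) := @pi1 squier w.
HB.instance Definition _ w := Group.on (diagram_group w).

End Squier.

Definition H1_graph := @Digraph unit unit (fun=> tt) (fun=> tt).

(* The cell (b, s) is the positive cell x^2 = x if b and x = x otherwise,
   inverted when s is false. *)
Definition H1_top (f : bool * bool) : seq unit :=
  match f with (true, true) => [:: tt; tt] | _ => [:: tt] end.
Definition H1_bot (f : bool * bool) : seq unit :=
  match f with (true, false) => [:: tt; tt] | _ => [:: tt] end.
Definition H1_inv (f : bool * bool) := (f.1, ~~ f.2).

Definition H1 : dir_complex.
Proof.
by apply: (@DirComplex H1_graph (bool * bool)%type H1_top H1_bot _ _ _ H1_inv
  _ _ _ _ snd _); do ?case; do ?case; do 2?[exists tt].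
Defined.

Definition H1_x : sq_vert H1 := @SqVert H1 [:: tt] isT.
(* A right action of F on A by group automorphisms. *)
Record aut_action (A F : groupType) := AutAction {
  aact :> A -> F -> A;
  aact1 : forall a, aact a 1%g = a;
  aactM : forall a f g, aact a (f * g)%g = aact (aact a f) g;
  aact_mul : forall a b f, aact (a * b)%g f = (aact a f * aact b f)%g
}.

(* The pair (a, f) stands for the product a f. *)
Record semidirect (A F : groupType) (act : aut_action A F) :=
  SemiDirect { sd_pair : A * F }.

Section Semidirect.
Variables (A F : groupType) (act : aut_action A F).
Local Open Scope group_scope.

Local Notation semidirect := (semidirect act).
Local Notation SemiDirect := (@SemiDirect A F act).
HB.instance Definition _ := [isNew of semidirect for @sd_pair A F act].
HB.instance Definition _ := [Choice of semidirect by <:].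
Implicit Types x y z : semidirect.

Definition sd_one := SemiDirect (1, 1).
Definition sd_mul x y :=
  let: (a, f) := sd_pair x in let: (b, g) := sd_pair y in
  SemiDirect (a * act b f^-1, f * g).
Definition sd_inv x :=
  let: (a, f) := sd_pair x in SemiDirect (act a^-1 f, f^-1).

Lemma aact1g f : act 1 f = 1.
Proof. by apply: (mulIg (act 1 f)); rewrite -aact_mul !mul1g. Qed.

Lemma sd_mulA : associative sd_mul.
Proof.
move=> [[a f]] [[b g]] [[c h]]; rewrite /sd_mul /=.
by rewrite aact_mul -aactM invgM !mulgA.
Qed.
Lemma sd_mul1 : left_id sd_one sd_mul.
Proof. by move=> [[a f]]; rewrite /sd_mul /=; rewrite invg1 aact1 !mul1g. Qed.
Lemma sd_1mul : right_id sd_one sd_mul.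
Proof. by move=> [[a f]]; rewrite /sd_mul /=; rewrite aact1g !mulg1. Qed.
Lemma sd_mulV : left_inverse sd_one sd_inv sd_mul.
Proof.
by move=> [[a f]]; rewrite /sd_mul /=; rewrite invgK -aact_mul !mulVg aact1g.
Qed.
Lemma sd_Vmul : right_inverse sd_one sd_inv sd_mul.
Proof. by move=> [[a f]]; rewrite /sd_mul /=; rewrite -aactM !mulgV aact1 mulgV. Qed.

HB.instance Definition _ :=
  isGroup.Build semidirect sd_mulA sd_mul1 sd_1mul sd_mulV sd_Vmul.

Definition sd_inl a := SemiDirect (a, 1).
Definition sd_inr f := SemiDirect (1, f).

Lemma sd_conj a f : (sd_inr f)^-1 * sd_inl a * sd_inr f = sd_inl (act a f).
Proof.
apply: (congr1 SemiDirect); congr pair.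
  by rewrite /= invgK -aact_mul invg1 mul1g aact1g mulg1.
by rewrite mulg1 mulVg.
Qed.

End Semidirect.

Section PiecewiseLinear.
Variable R : realType.
Local Open Scope ring_scope.
Local Notation I := {i01 R}.
Implicit Types (h : I -> I) (a b s t : I).

Definition dyadic (x : R) := exists (n : int) (k : nat), x = n%:~R / 2 ^+ k.

Definition affine_on h a b (m : R) := forall s t,
  a <= s <= b -> a <= t <= b -> (h t)%:num - (h s)%:num = m * (t%:num - s%:num).

(* Continuous piecewise linear maps. A map is required to be affine on closed
   intervals between consecutive points of a finite set, including their end
   points, so that continuity is built in. *)
Definition cpl h := exists p : seq I, forall a b, a < b ->
  (forall t, t \in p -> ~~ (a < t < b)) -> exists m, affine_on h a b m.

(* A singularity is an interior point near which the map is not affine. *)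
Definition singularity h t := 0 < t%:num < 1 /\
  ~ exists a b m, a < t < b /\ affine_on h a b m.

Definition slope h (m : R) := exists a b, a < b /\ affine_on h a b m.

Definition cpl2 h := [/\ cpl h,
  forall t, singularity h t -> dyadic t%:num
  & forall m, slope h m -> exists k : int, m = 2 ^ k].

Definition in_Phi h :=
  [/\ cpl2 h, dyadic (h 0%:i01)%:num & dyadic (h 1%:i01)%:num].

Definition in_F h :=
  [/\ cpl2 h, {homo h : s t / s < t} & forall u, exists t, h t = u].

Definition avoids (p : seq I) a b := forall t, t \in p -> ~~ (a < t < b).

Lemma avoids_cons u p a b :
  avoids (u :: p) a b <-> ~~ (a < u < b) /\ avoids p a b.
Proof.
split=> [h|[hu hp] t]; last by rewrite inE => /orP[/eqP ->|/hp].
by split=> [|t tp]; apply: h; rewrite inE ?eqxx// tp orbT.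
Qed.

Lemma avoids_sub p a b a' b' :
  a <= a' -> b' <= b -> avoids p a b -> avoids p a' b'.
Proof.
move=> aa bb h t /h; apply: contra => /andP[h1 h2].
by rewrite (le_lt_trans aa h1) (lt_le_trans h2 bb).
Qed.

Lemma pieces_ind (p : seq I) (P : I -> I -> Prop) :
    (forall a b, a < b -> avoids p a b -> P a b) ->
    (forall a c b, c \in p -> a < c -> c < b -> P a c -> P c b -> P a b) ->
  forall a b, a < b -> P a b.
Proof.
elim: p => [|u p IHp] Pbase Pjoin; first by move=> a b ab; apply: Pbase.
apply: IHp => [a b ab abp|a c b cp]; last first.
  by apply: Pjoin; rewrite inE cp orbT.
have [/andP[au ub]|aub] := boolP (a < u < b); last first.
  by apply: Pbase => //; apply/avoids_cons.
apply: (Pjoin a u b) => //; first by rewrite inE eqxx.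
- apply: Pbase => //; apply/avoids_cons; rewrite ltxx andbF.
  by split=> //; apply: avoids_sub abp => //; apply: ltW.
- apply: Pbase => //; apply/avoids_cons; rewrite ltxx.
  by split=> //; apply: avoids_sub abp => //; apply: ltW.
Qed.

Lemma avoids_nbhd p t : 0 < t%:num < 1 -> t \notin p ->
  exists a b, a < t < b /\ avoids p a b.
Proof.
move=> /andP[t0 t1]; elim: p => [_|u p IHp].
  by exists 0%:i01, 1%:i01; split=> //; apply/andP; split.
rewrite inE negb_or => /andP[tu /IHp[a [b [/andP[at_ tb] ab]]]].
have [ut|] := ltP u t.
  exists (Order.max a u), b; rewrite gt_max at_ ut tb; split=> //.
  apply/avoids_cons; split; first by rewrite gt_max ltxx andbF.
  by apply: avoids_sub ab => //; rewrite le_max lexx.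
rewrite le_eqVlt (negPf tu) /= => ut.
exists a, (Order.min b u); rewrite lt_min at_ ut tb; split=> //.
apply/avoids_cons; split; first by rewrite lt_min ltxx !andbF.
by apply: avoids_sub ab => //; rewrite ge_min lexx.
Qed.

Lemma avoids_inside p a b : a < b ->
  exists a' b', [/\ a <= a', b' <= b, a' < b' & avoids p a' b'].
Proof.
move: a b; apply: (@pieces_ind p) => [a b ab abp|a c b _ ac cb].
  by exists a, b.
move=> [a' [b' [h1 h2 h3 h4]]] _; exists a', b'; split=> //.
exact: le_trans h2 (ltW cb).
Qed.

Lemma affine_sub h a b a' b' m :
  a <= a' -> b' <= b -> affine_on h a b m -> affine_on h a' b' m.
Proof.
move=> aa bb hm s t /andP[s1 s2] /andP[t1 t2]; apply: hm.
  by rewrite (le_trans aa s1) (le_trans s2 bb).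
by rewrite (le_trans aa t1) (le_trans t2 bb).
Qed.

Lemma affine_uniq h a b m n :
  a < b -> affine_on h a b m -> affine_on h a b n -> m = n.
Proof.
move=> ab hm hn.
have := hm a b; rewrite hn ?lexx ?(ltW ab)// => /(_ isT isT) /eqP.
rewrite -subr_eq0 -mulrBl mulf_eq0 !subr_eq0 => /orP[/eqP //|/eqP e].
by move: ab; rewrite (val_inj e) ltxx.
Qed.

Lemma affine_join h a c b m : a < c -> c < b ->
  affine_on h a c m -> affine_on h c b m -> affine_on h a b m.
Proof.
move=> ac cb h1 h2.
have to_c s : a <= s <= b -> (h s)%:num - (h c)%:num = m * (s%:num - c%:num).
  move=> /andP[as_ sb]; have [sc|cs] := leP s c.
    by apply: h1; rewrite ?as_ ?sc ?(ltW ac) ?lexx.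
  by apply: h2; rewrite ?sb ?(ltW cs) ?(ltW cb) ?lexx.
move=> s t /to_c hs /to_c ht.
by rewrite -(subrKA (h c)%:num) -[X in _ + X]opprB ht hs; ring.
Qed.

Lemma cpl2P h : cpl2 h <-> exists2 p : seq I,
  (forall t, t \in p -> dyadic t%:num) &
  forall a b, a < b -> avoids p a b -> exists k : int, affine_on h a b (2 ^ k).
Proof.
split=> [[[p hp] hsing hslope]|[p pd hp]]; last first.
  split.
  - by exists p => a b ab /(hp a b ab)[k hk]; exists (2 ^ k).
  - move=> t [t01 nt]; have [/pd //|tp] := boolP (t \in p).
    have [a [b [/andP[at_ tb] /(hp _ _ (lt_trans at_ tb))[k hk]]]] :=
      avoids_nbhd t01 tp.
    by case: nt; exists a, b, (2 ^ k); rewrite at_ tb.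
  - move=> m [a [b [ab hm]]].
    have [a' [b' [aa bb ab' /(hp _ _ ab')[k hk]]]] := avoids_inside p ab.
    by exists k; apply: affine_uniq ab' (affine_sub aa bb hm) hk.
suff [q qd hq] : exists2 q : seq I, (forall t, t \in q -> dyadic t%:num) &
    forall a b, a < b -> avoids q a b -> exists m, affine_on h a b m.
  exists q => // a b ab /(hq a b ab)[m hm].
  have [|k mk] := hslope m; first by exists a, b.
  by exists k; rewrite -mk.
have {hp} : forall a b, a < b -> avoids ([::] ++ p) a b ->
    exists m, affine_on h a b m by exact: hp.
have : forall t, t \in ([::] : seq I) -> dyadic t%:num by [].
move: [::] => q; elim: p q => [|u p IHp] q qd hq.
  by exists q => //; move: hq; rewrite cats0.
have [su|nsu] := pselect (dyadic u%:num).
  apply: (IHp (rcons q u)) => [t|]; last by rewrite cat_rcons.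
  by rewrite mem_rcons inE => /orP[/eqP ->|/qd].
apply: (IHp q) => // a b ab abqp.
have avu c d : ~~ (c < u < d) -> avoids (q ++ p) c d -> avoids (q ++ u :: p) c d.
  move=> cud cd t; rewrite mem_cat inE orbCA -mem_cat => /orP[/eqP ->//|].
  exact: cd.
have [/andP[au ub]|aub] := boolP (a < u < b); last exact/hq/avu.
have [|m1 hm1] := hq a u au.
  by apply: avu; rewrite ?ltxx ?andbF//; apply: avoids_sub abqp => //; apply: ltW.
have [|m2 hm2] := hq u b ub.
  by apply: avu; rewrite ?ltxx ?andbF//; apply: avoids_sub abqp => //; apply: ltW.
have u01 : 0 < u%:num < 1.
  apply/andP; split; first by apply: le_lt_trans (_ : a%:num < _).
  by apply: (@lt_le_trans _ _ b%:num).
have [[c [d [m [/andP[cu ud] hm]]]]|nex] := pselect (exists a b m, a < u < b /\ affine_on h a b m);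
  last by case: nsu; apply: hsing; split.
pose c' := Order.max a c; pose d' := Order.min b d.
have c'u : c' < u by rewrite gt_max au cu.
have ud' : u < d' by rewrite lt_min ub ud.
have ac' : a <= c' by rewrite le_max lexx.
have cc' : c <= c' by rewrite le_max lexx orbT.
have bd' : d' <= b by rewrite ge_min lexx.
have dd' : d' <= d by rewrite ge_min lexx orbT.
have e1 : m1 = m.
  apply: (affine_uniq c'u (affine_sub ac' (lexx _) hm1)).
  exact: affine_sub cc' (ltW ud) hm.
have e2 : m2 = m.
  apply: (affine_uniq ud' (affine_sub (lexx _) bd' hm2)).
  exact: affine_sub (ltW cu) dd' hm.
exists m; apply: (affine_join au ub); first by rewrite -e1.
by rewrite -e2.
Qed.

Lemma dyadicN x : dyadic x -> dyadic (- x).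
Proof. by move=> [n [k ->]]; exists (- n), k; rewrite mulrNz mulNr. Qed.

Lemma dyadicD x y : dyadic x -> dyadic y -> dyadic (x + y).
Proof.
move=> [n [k ->]] [m [l ->]]; exists (n * 2 ^+ l + m * 2 ^+ k), (k + l)%N.
have k0 : 2 ^+ k != 0 :> R by rewrite expf_neq0// pnatr_eq0.
have l0 : 2 ^+ l != 0 :> R by rewrite expf_neq0// pnatr_eq0.
by rewrite intrD !intrM !rmorphXn /= exprD; field; rewrite k0 l0.
Qed.

Lemma dyadicZ (k : int) x : dyadic x -> dyadic (2 ^ k * x).
Proof.
move=> [n [l ->]]; case: k => k.
  by exists (n * 2 ^+ k), l; rewrite intrM rmorphXn /= -exprnP mulrCA mulrA.
exists n, (k.+1 + l)%N; rewrite NegzE -exprnN exprD invfM.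
by rewrite mulrCA -[(2 ^- k.+1)]/((2 ^+ k.+1)^-1).
Qed.

Lemma dyadic_affine h a b (k : int) t : affine_on h a b (2 ^ k) ->
  a <= t <= b -> dyadic a%:num -> dyadic (h a)%:num ->
  dyadic t%:num <-> dyadic (h t)%:num.
Proof.
move=> hk atb da dha; have aa : a <= a <= b.
  by case/andP: atb => h1 h2; rewrite lexx (le_trans h1).
have e := hk a t aa atb; split=> dt.
  rewrite -(subrK (h a)%:num (h t)%:num) e.
  by apply: dyadicD dha; apply/dyadicZ/dyadicD => //; apply: dyadicN.
have -> : t%:num = 2 ^ (- k) * ((h t)%:num - (h a)%:num) + a%:num.
  by rewrite e mulrA -expfzDr ?pnatr_eq0// addNr expr0z mul1r subrK.
by apply: dyadicD da; apply/dyadicZ/dyadicD => //; apply: dyadicN.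
Qed.

Lemma cpl2_lt h : cpl2 h -> {homo h : s t / s < t}.
Proof.
move=> /cpl2P[p _ hp]; apply: (@pieces_ind p) => [a b ab|a c b _ _ _].
  move=> /(hp _ _ ab)[k hk].
  have e : (h b)%:num - (h a)%:num = 2 ^ k * (b%:num - a%:num).
    by apply: hk; apply/andP; split=> //; apply: ltW.
  suff : (h a)%:num < (h b)%:num by [].
  by rewrite -subr_gt0 e mulr_gt0 ?exprz_gt0// subr_gt0.
exact: lt_trans.
Qed.

Lemma i01_ge0 t : 0%:i01 <= t. Proof. by change (0 <= t%:num). Qed.
Lemma i01_le1 t : t <= 1%:i01. Proof. by change (t%:num <= 1). Qed.

Lemma dyadic0 : dyadic 0. Proof. by exists 0, 0%N; rewrite mul0r. Qed.
Lemma dyadic1 : dyadic 1. Proof. by exists 1, 0%N; rewrite divr1. Qed.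

Lemma cpl2_dyadic h : cpl2 h -> dyadic (h 0%:i01)%:num ->
  forall t, dyadic t%:num <-> dyadic (h t)%:num.
Proof.
move=> /cpl2P[p pd hp] d0.
suff main a b : a < b -> dyadic a%:num -> dyadic (h a)%:num ->
    forall t, a <= t <= b -> dyadic t%:num <-> dyadic (h t)%:num.
  have z1 : 0%:i01 < 1%:i01 :> I by change (0 < 1 :> R).
  by move=> t; apply: (main _ _ z1 dyadic0 d0); rewrite i01_ge0 i01_le1.
move: a b; apply: (@pieces_ind p) => [a b ab /(hp _ _ ab)[k hk] da dha t tab|].
  exact: dyadic_affine hk tab da dha.
move=> a c b /pd dc ac cb IH1 IH2 da dha t /andP[at_ tb].
have [tc|ct] := leP t c; first by apply: IH1 => //; rewrite at_.
apply: IH2 => //; last by rewrite (ltW ct).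
have acc : a <= c <= c by apply/andP; split=> //; apply: ltW.
by case: (IH1 da dha c acc) => + _; apply.
Qed.

Lemma preim_seq h (q : seq I) : injective h ->
  exists p : seq I, forall t, (t \in p) = (h t \in q).
Proof.
move=> hinj; elim: q => [|u q [p pE]]; first by exists [::].
have [[v <-]|nu] := pselect (exists v, h v = u).
  by exists (v :: p) => t; rewrite !inE pE (inj_eq hinj).
by exists p => t; rewrite inE pE; case: eqP => // e; case: nu; exists t.
Qed.

Lemma cpl2_inj h : cpl2 h -> injective h.
Proof. by move=> /cpl2_lt/le_mono; apply: inc_inj. Qed.

Lemma affine_onto h a b m : a < b -> 0 < m -> affine_on h a b m ->
  forall u, h a < u -> u < h b -> exists2 t, a < t < b & h t = u.
Proof.
move=> ab m0 hm u au ub.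
have bnd : a%:num < a%:num + (u%:num - (h a)%:num) / m < b%:num.
  apply/andP; split; first by rewrite ltrDl divr_gt0// subr_gt0.
  rewrite -ltrBrDl ltr_pdivrMr// mulrC -(hm a b) ?lexx ?(ltW ab)//.
  by rewrite ltrD2r.
have [ta tb] := andP bnd.
have t0 : 0 <= a%:num + (u%:num - (h a)%:num) / m.
  by apply: le_trans (ltW ta).
have t1 : a%:num + (u%:num - (h a)%:num) / m <= 1.
  by apply: le_trans (ltW tb) _.
pose t : I := Itv01 t0 t1; exists t; first exact: bnd.
apply: val_inj => /=; apply: (addIr (- (h a)%:num)).
rewrite (hm a t) ?lexx ?(ltW ab)//=; last by rewrite !ltW.
by rewrite addrAC subrr add0r mulrC divfK// gt_eqF.
Qed.

Lemma cpl2_comp g h : cpl2 g -> dyadic (g 0%:i01)%:num -> cpl2 h ->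
  cpl2 (h \o g).
Proof.
move=> cg dg0 ch; have gmono := le_mono (cpl2_lt cg).
have gd := cpl2_dyadic cg dg0.
move: ch => /cpl2P[q qd hq].
have [r rE] := preim_seq q (cpl2_inj cg).
have glt := cpl2_lt cg; move: cg => /cpl2P[p pd gp].
apply/cpl2P; exists (p ++ r) => [t|a b ab abpr].
  by rewrite mem_cat => /orP[/pd//|]; rewrite rE => /qd; apply: (gd _).2.
have [k gk] : exists k : int, affine_on g a b (2 ^ k).
  by apply: gp => // t tp; apply: abpr; rewrite mem_cat tp.
have [l hl] : exists l : int, affine_on h (g a) (g b) (2 ^ l).
  apply: hq; first exact: glt.
  move=> u uq; apply/negP => /andP[gau ugb].
  have [|t tab tu] := affine_onto ab _ gk gau ugb; first exact: exprz_gt0.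
  by have := abpr t; rewrite mem_cat rE tu uq orbT tab => /(_ isT).
exists (l + k) => s t sab tab /=.
have gab u : a <= u <= b -> g a <= g u <= g b by rewrite !gmono.
rewrite (hl _ _ (gab _ sab) (gab _ tab)) (gk _ _ sab tab) mulrA.
by rewrite expfzDr// pnatr_eq0.
Qed.

Lemma cpl2_id : cpl2 id.
Proof.
apply/cpl2P; exists [::] => // a b _ _; exists 0 => s t _ _.
by rewrite expr0z mul1r.
Qed.

Lemma in_F_fix0 h : in_F h -> h 0%:i01 = 0%:i01.
Proof.
move=> [_ /le_mono hm /(_ 0%:i01)[t ht]]; apply: le_anti.
by rewrite i01_ge0 -{2}ht hm i01_ge0.
Qed.

Lemma in_F_fix1 h : in_F h -> h 1%:i01 = 1%:i01.
Proof.
move=> [_ /le_mono hm /(_ 1%:i01)[t ht]]; apply: le_anti.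
by rewrite i01_le1 -{1}ht hm i01_le1.
Qed.

Lemma in_F_Phi h : in_F h -> in_Phi h.
Proof.
move=> Fh; split; first by case: Fh.
  by rewrite in_F_fix0//; exact: dyadic0.
by rewrite in_F_fix1//; exact: dyadic1.
Qed.

Lemma in_F_id : in_F id.
Proof. by split=> //; [exact: cpl2_id|move=> u; exists u]. Qed.

Lemma in_F_comp g h : in_F g -> in_F h -> in_F (h \o g).
Proof.
move=> Fg Fh; have [_ dg0 _] := in_F_Phi Fg.
case: Fg Fh => [cg mg sg] [ch mh sh]; split.
- exact: cpl2_comp.
- by move=> s t st /=; apply/mh/mg.
- by move=> u; have [t <-] := sh u; have [s <-] := sg t; exists s.
Qed.

Lemma in_Phi_comp h g : in_Phi h -> in_F g -> in_Phi (g \o h).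
Proof.
move=> [ch d0 d1] Fg; have [cg dg0 _] := in_F_Phi Fg; split.
- exact: cpl2_comp.
- exact: (cpl2_dyadic cg dg0 (h 0%:i01)).1.
- exact: (cpl2_dyadic cg dg0 (h 1%:i01)).1.
Qed.

Lemma in_F_inv g g' : in_F g -> cancel g g' -> cancel g' g -> in_F g'.
Proof.
move=> Fg gK g'K; have [_ dg0 _] := in_F_Phi Fg.
case: Fg => [cg mg _].
have gmono := le_mono mg; have ginc := leW_mono gmono.
have lt' : {homo g' : s t / s < t} by move=> s t; rewrite -{1}[s]g'K -{1}[t]g'K ginc.
have le'E := le_mono lt'.
split=> //; last by move=> u; exists (g u).
have gd := cpl2_dyadic cg dg0; move: cg => /cpl2P[p pd gp].
apply/cpl2P; exists (map g p) => [_ /mapP[t /pd dt ->]|a b ab abp].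
  exact: (gd _).1.
have [k gk] : exists k : int, affine_on g (g' a) (g' b) (2 ^ k).
  apply: gp; first exact: lt'.
  move=> t tp; have := abp (g t) (map_f g tp).
  by rewrite -{1}[a]g'K -{1}[b]g'K !ginc.
exists (- k) => s t sab tab.
rewrite -{2}[t]g'K -{2}[s]g'K (gk (g' s) (g' t)) ?le'E//.
by rewrite mulrA -expfzDr ?pnatr_eq0// addNr expr0z mul1r.
Qed.

End PiecewiseLinear.

Section ThompsonGroup.
Variable R : realType.
Local Notation I := {i01 R}.

Record Phi := MkPhi { Phi_fun :> I -> I; Phi_funP : `[< in_Phi Phi_fun >] }.
HB.instance Definition _ := [isSub for Phi_fun].
HB.instance Definition _ := [Choice of Phi by <:].

Record thompson := MkThompson {
  thompson_fun :> I -> I;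
  thompson_funP : `[< in_F thompson_fun >]
}.
HB.instance Definition _ := [isSub for thompson_fun].
HB.instance Definition _ := [Choice of thompson by <:].

Lemma thompson_in_F (g : thompson) : in_F g.
Proof. exact/asboolP/thompson_funP. Qed.

Lemma Phi_in (h : Phi) : in_Phi h.
Proof. exact/asboolP/Phi_funP. Qed.

Lemma thompson_inv_ex (g : thompson) : exists g' : thompson,
  cancel g g' /\ cancel g' g.
Proof.
have Fg := thompson_in_F g; case: (Fg) => [_ /le_mono gm gs].
pose g' u := projT1 (cid (gs u)).
have g'K : cancel g' g by move=> u; rewrite /g'; case: cid.
have gK : cancel g g' by move=> u; apply: (inc_inj gm); rewrite g'K.
by exists (MkThompson (asboolT (in_F_inv Fg gK g'K))).
Qed.

(* The product f g is "first f, then g". *)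
Definition th_one := MkThompson (asboolT (@in_F_id R)).
Definition th_mul (f g : thompson) :=
  MkThompson (asboolT (in_F_comp (thompson_in_F f) (thompson_in_F g))).
Definition th_inv (g : thompson) : thompson := projT1 (cid (thompson_inv_ex g)).

Lemma th_mulA : associative th_mul. Proof. by move=> f g h; apply: val_inj. Qed.
Lemma th_mul1 : left_id th_one th_mul. Proof. by move=> f; apply: val_inj. Qed.
Lemma th_1mul : right_id th_one th_mul. Proof. by move=> f; apply: val_inj. Qed.
Lemma th_mulV : left_inverse th_one th_inv th_mul.
Proof.
move=> g; apply: val_inj; apply/funext => t.
by rewrite /= /th_inv; case: cid => g' [gK g'K] /=.
Qed.
Lemma th_Vmul : right_inverse th_one th_inv th_mul.
Proof.
move=> g; apply: val_inj; apply/funext => t.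
by rewrite /= /th_inv; case: cid => g' [gK g'K] /=.
Qed.

HB.instance Definition _ :=
  isGroup.Build thompson th_mulA th_mul1 th_1mul th_mulV th_Vmul.

(* The composition "first h, then g". *)
Definition Phi_mul (h : Phi) (g : thompson) : Phi :=
  MkPhi (asboolT (in_Phi_comp (Phi_in h) (thompson_in_F g))).

Local Open Scope classical_set_scope.

Definition Phi_image (h : Phi) : set R := [set (h t)%:num%R | t in [set: I]].

Definition disjoint_images (h1 h2 : Phi) :=
  (Phi_image h1)^° `&` (Phi_image h2)^° = set0.

Definition groupA := pc_group disjoint_images.
HB.instance Definition _ := Group.on groupA.

Definition alpha (h : Phi) : groupA := pc_gen disjoint_images h.

End ThompsonGroup.

(* Main.v *)
(* Choose at every vertex of the Squier complex the path to [x] that always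
   merges the two rightmost letters.  Relative to this spanning tree the edge
   x^p (x^2 = x) x^r depends on p only as soon as r > 0, and is trivial for
   r = 0; call it x_p.  The edges x^p (x = x) x^r give elements y_p (r > 0) and
   z_p (r = 0).  The squares say that conjugation by x_p shifts all later
   indices by one, and that y_p commutes with everything to its right.

   On the other side, iterated halving of [0, 1] gives p-th leaves
   [1 - 2^-p, 1 - 2^-(p + 1)] and last leaves [1 - 2^-p, 1] of right combs; F
   contains maps a_p satisfying the relations of the x_p, and the affine
   parametrizations of these leaves satisfy, under F, the relations of y_p and
   z_p.  This yields the homomorphism from the diagram group to the semidirect
   product.

   For the inverse, x_p -> a_p is injective on the subgroup generated by the
   x_p (words reduce to fractions of sorted words, and a sorted word can be read
   off from its function), and the a_p generate F (every element of F maps the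
   leaves of a binary tree to the leaves of another one), so F embeds in the
   diagram group.  Every h in Phi is a comb leaf followed by some g in F; alpha_h
   is sent to y_p (or z_p) conjugated by g.  This is well defined because the
   stabilizer in F of a comb leaf is a product of scaled copies of F whose
   generators commute with y_p (or z_p). *)
Require Import Defs.
From HB Require Import structures.
From mathcomp Require Import all_boot all_order all_algebra.
From mathcomp Require Import boolp classical_sets reals.
From mathcomp Require Import topology normedtype interval_inference.
From Stdlib Require Import Relation_Operators.
From mathcomp Require Import ring lra zify.
Set Implicit Arguments.
Unset Strict Implicit.
Unset Printing Implicit Defensive.
Import Order.TTheory GRing.Theory Num.Theory.
Import numFieldNormedType.Exports.

(** * Groups, presentations and fundamental groups *)

Section GroupFacts.
Variable G : groupType.
Local Open Scope group_scope.
Implicit Types x y z g : G.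

Lemma commute_conj x y g : commute x y -> commute (x ^ g) (y ^ g).
Proof. by rewrite /commute => xy; rewrite -!conjMg xy. Qed.

Lemma conj_commute x g : commute g x -> x ^ g = x.
Proof. by rewrite /commute => gx; rewrite conjgE -gx mulKg. Qed.

Lemma mul_eq_div x y z t : x * y = z * t -> z^-1 * x = t * y^-1.
Proof. by move=> e; rewrite -[x](mulgK y) e -!mulgA mulKg. Qed.

(** Both [x] and [z] conjugate [y] to the same [y'], so their quotient centralizes [y]. *)
Lemma commute_div x y y' z : x * y = y' * x -> z * y = y' * z ->
  commute y (x^-1 * z).
Proof.
move=> xy zy; rewrite /commute -[RHS]mulgA zy !mulgA; congr (_ * _).
by apply: (mulgI x); rewrite !mulgA xy mulgV mul1g mulgK.
Qed.

End GroupFacts.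

Section Morphisms.
Variables (G K : groupType) (f : {multiplicative G -> K}).
Local Open Scope group_scope.

Lemma mult1 : f 1 = 1.
Proof. by apply: (mulgI (f 1)); rewrite -gmulfM !mulg1. Qed.

Lemma multV x : f x^-1 = (f x)^-1.
Proof. by apply: (mulgI (f x)); rewrite -gmulfM !mulgV mult1. Qed.

Lemma mult_prod I (s : seq I) (F : I -> G) :
  f (\prod_(i <- s) F i) = \prod_(i <- s) f (F i).
Proof. by elim: s => [|i s IHs]; rewrite ?big_nil ?mult1// !big_cons gmulfM IHs. Qed.

End Morphisms.

(** * Homomorphisms out of quotients, presented groups and fundamental groups *)

Section Lifts.
Local Open Scope group_scope.

Lemma rst_class_ind (P : pregroup) (K : Type) (step : P -> P -> Prop)
    (f : P -> K) : (forall x y, step x y -> f x = f y) ->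
  forall x y, clos_refl_sym_trans _ step x y -> f x = f y.
Proof. by move=> fs x y; elim=> [{}x {}y /fs|//|{}x {}y _ ->|{}x {}y z _ -> _]. Qed.

Lemma quot_lift (P : pregroup) (K : groupType) (f : P -> K) :
    (forall x y, pg_eqv x y -> f x = f y) ->
    (forall x y, f (pg_mul x y) = f x * f y) ->
  exists phi : {multiplicative quot_group P -> K},
    forall x, phi (qclass x) = f x.
Proof.
move=> fE fM; pose phi0 (a : quot_group P) := f (qrepr a).
have phi0M : {morph phi0 : a b / a * b}.
  move=> a b; rewrite /phi0 -fM; apply: fE.
  by rewrite -{1}[a]qreprK -{1}[b]qreprK qclassM; exact: qreprP.
pose phiM := isMultiplicative.Build _ _ phi0 phi0M.
exists (HB.pack_for {multiplicative quot_group P -> K} phi0 phiM) => x /=.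
by apply: fE; exact: qreprP.
Qed.

Section Presented.
Variables (X : choiceType) (relator : seq (X * bool) -> Prop) (K : groupType).

Definition letter (v : X -> K) (a : X * bool) := if a.2 then v a.1 else (v a.1)^-1.

Lemma word_class r : @qclass (presented relator) r =
  \prod_(a <- r) (if a.2 then pres_gen relator a.1 else (pres_gen relator a.1)^-1).
Proof.
have genV x : (pres_gen relator x)^-1 = @qclass (presented relator) [:: (x, false)].
  exact: qclassV.
elim: r => [|[x b] s IHs]; first by rewrite big_nil.
have -> : @qclass (presented relator) ((x, b) :: s) =
    (@qclass (presented relator) [:: (x, b)] : pres_group relator) *
    @qclass (presented relator) s by exact/esym/qclassM.
by rewrite big_cons -IHs; case: b => //=; rewrite genV.
Qed.

Lemma relator_class r : relator r -> @qclass (presented relator) r = 1.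
Proof.
move=> rr; apply/qclassP; apply: rst_step.
by rewrite -[r]cats0 -[r ++ _]cat0s; exact: (@PresRelator _ _ [::] r [::]).
Qed.

Lemma pres_lift (v : X -> K) :
    (forall r, relator r -> \prod_(a <- r) letter v a = 1) ->
  exists phi : {multiplicative pres_group relator -> K},
    forall x, phi (pres_gen relator x) = v x.
Proof.
move=> vr.
have [|s t|phi phiE] := @quot_lift (presented relator) K
    (fun s => \prod_(a <- s) letter v a).
- apply: (@rst_class_ind (presented relator)) => s t [u x b w|u r w /vr rE].
    rewrite !big_cat /= !big_cons !big_nil /letter /= mulg1.
    by case: b; rewrite /= ?mulgV ?mulVg mul1g.
  by rewrite !big_cat /= rE mul1g.
- by rewrite big_cat.
- by exists phi => x; rewrite phiE big_cons big_nil mulg1.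
Qed.

Lemma pres_ind (P : pres_group relator -> Prop) :
    P 1 -> (forall a b, P a -> P b -> P (a * b)) -> (forall a, P a -> P a^-1) ->
    (forall x, P (pres_gen relator x)) -> forall a, P a.
Proof.
move=> P1 PM PV PX a; rewrite -[a]qreprK word_class.
elim: (qrepr a) => [|[x b] s IHs]; first by rewrite big_nil.
by rewrite big_cons; apply: PM IHs; case: b; [exact: PX|exact/PV/PX].
Qed.

End Presented.

Lemma pc_gen_commute (X : choiceType) (comm : X -> X -> Prop) x y :
  comm x y -> commute (pc_gen comm x) (pc_gen comm y).
Proof.
move=> xy; have /relator_class : comm_relator comm
    [:: (x, false); (y, false); (x, true); (y, true)] by exists x, y.
rewrite word_class !big_cons big_nil /= mulg1 => e.
apply: (mulgI (pc_gen comm y)^-1); apply: (mulgI (pc_gen comm x)^-1).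
by rewrite [LHS]e mulKg mulVg.
Qed.

(** * Edge labellings and based loops *)

Section Pi1.
Variables (X : complex2) (w : dvert X).

(** The product of the labels along a loop survives deletion of a spur, as labels invert with edges,
    and of a face boundary, whose product is 1. *)
Lemma pi1_lift (K : groupType) (v : dedge X -> K) :
    (forall e, v (einv e) = (v e)^-1) ->
    (forall c, \prod_(e <- bdry c) v e = 1) ->
  exists phi : {multiplicative pi1 w -> K},
    forall l, phi (homotopy_class l) = \prod_(e <- loop_seq l) v e.
Proof.
move=> vV vc.
have [|s t|phi phiE] := @quot_lift (@loops X w) K
    (fun l => \prod_(e <- loop_seq l) v e).
- apply: (@rst_class_ind (@loops X w)) => s t [u e r -> ->|u c r -> ->].
    by rewrite !big_cat /= !big_cons !big_nil vV mulg1 mulgV mul1g.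
  by rewrite !big_cat /= vc mul1g.
- by rewrite /= big_cat.
- by exists phi.
Qed.

Variable tau : dvert X -> seq (dedge X).
Hypothesis tauP : forall v, dpath v (tau v) w.
Hypothesis tau_base : tau w = [::].

Lemma based_subproof s x y : dpath x s y ->
  dpath w (path_inv (tau x) ++ s ++ tau y) w.
Proof.
move=> xy; apply/dpath_catP; exists x; first exact/dpath_inv/tauP.
by apply/dpath_catP; exists y.
Qed.

(** A path from [x] to [y] is closed up at [w] by the reverse of [tau x] and by [tau y]. *)
Definition based s x y (xy : dpath x s y) : pi1 w :=
  homotopy_class (Loop (based_subproof xy)).

Lemma edge_dpath (e : dedge X) : dpath (src e) [:: e] (tgt e).
Proof. by rewrite /= !eqxx. Qed.

Definition based_edge e : pi1 w := based (edge_dpath e).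

Lemma based_homotopic s t x y (sp : dpath x s y) (tp : dpath x t y) :
    (forall l m : @loop X w,
      loop_seq l = path_inv (tau x) ++ s ++ tau y ->
      loop_seq m = path_inv (tau x) ++ t ++ tau y ->
    homotopic l m) -> based sp = based tp.
Proof. by move=> h; apply/qclassP/h. Qed.

Lemma based_nil x (h : dpath x [::] x) : based h = 1.
Proof.
apply/qclassP/(@hom_spur _ _ [::] (path_inv (tau x)) [::]) => //=.
by rewrite path_invK cats0.
Qed.

Lemma based_cat s t x y z (sp : dpath x s y) (tp : dpath y t z)
  (stp : dpath x (s ++ t) z) : based stp = based sp * based tp.
Proof.
rewrite [RHS]qclassM; apply/qclassP/rst_sym.
apply: (@hom_spur _ _ (path_inv (tau x) ++ s) (tau y) (t ++ tau z)) => /=.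
  by rewrite -!catA.
by rewrite -!catA.
Qed.

Lemma based_prod s x y (h : dpath x s y) : based h = \prod_(e <- s) based_edge e.
Proof.
elim: s x h => [|e s IHs] x h.
  by move: h (h) => /eqP <- h; rewrite big_nil based_nil.
have [/eqP ex es] := andP h; subst x.
by rewrite big_cons -(IHs _ es) -(based_cat (edge_dpath e) es h).
Qed.

Lemma based_edgeV e : based_edge (einv e) = (based_edge e)^-1.
Proof.
have h : dpath (src e) ([:: e] ++ [:: einv e]) (src e).
  by rewrite /= src_einv tgt_einv !eqxx.
have h1 : dpath (src e) [::] (src e) by rewrite /= eqxx.
have : based h = 1.
  rewrite -(based_nil h1); apply: based_homotopic => l m lE mE.
  apply: (@hom_spur _ _ (path_inv (tau (src e))) [:: e] (tau (src e))) => //.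
by rewrite based_prod !big_cons big_nil mulg1 => /mulg1_eq.
Qed.

Lemma based_bdry c : \prod_(e <- bdry c) based_edge e = 1.
Proof.
have [x h] := bdry_loop c; have h1 : dpath x [::] x by rewrite /= eqxx.
rewrite -(based_prod h) -(based_nil h1).
apply: based_homotopic => l m lE mE; apply: rst_step.
exact: (@HomotopyFace _ _ _ _ (path_inv (tau x)) c (tau x)).
Qed.

(** The closed-up loop runs back along [tau (src e)] and then retraces it, which is a spur. *)
Lemma based_tree_edge e : tau (src e) = e :: tau (tgt e) -> based_edge e = 1.
Proof.
move=> te; have h : dpath w [::] w by rewrite /= eqxx.
apply/qclassP/(@hom_spur _ _ [::] (path_inv (tau (src e))) [::]) => //=.
by rewrite path_invK te cats0.
Qed.

(** As [tau w] is empty, closing up a loop at [w] does not change it; hence the based edges generate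
    the fundamental group. *)
Lemma class_prod (l : @loop X w) :
  homotopy_class l = \prod_(e <- loop_seq l) based_edge e.
Proof.
rewrite -(based_prod (loopP l)); congr homotopy_class.
by apply: val_inj; rewrite /= tau_base cats0.
Qed.

Lemma based_edge_class e : exists2 l : @loop X w, based_edge e = homotopy_class l &
  loop_seq l = path_inv (tau (src e)) ++ e :: tau (tgt e).
Proof. by exists (Loop (based_subproof (edge_dpath e))). Qed.

End Pi1.
End Lifts.

(** * Scaled copies of maps on the two halves of the unit interval *)

Section Halves.
Variable R : realType.
Local Open Scope ring_scope.
Local Notation I := {i01 R}.
Implicit Types (f g h : I -> I) (s t u a b : I).

Lemma i01_bounds t : 0 <= t%:num <= 1.
Proof. by apply/andP; split; [exact: i01_ge0|exact: i01_le1]. Qed.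

Lemma clamp_ge0 (r : R) : 0 <= Order.max 0 (Order.min 1 r).
Proof. by rewrite le_max lexx. Qed.

Lemma clamp_le1 (r : R) : Order.max 0 (Order.min 1 r) <= 1.
Proof. by rewrite ge_max ler01 ge_min lexx. Qed.

(** A total retraction of the reals onto [I]: points can be given by formulas, and bounds are
    checked only when a value is computed. *)
Definition clamp (r : R) : I := Itv01 (clamp_ge0 r) (clamp_le1 r).

Lemma clampE r : 0 <= r <= 1 -> (clamp r)%:num = r.
Proof. by move=> /andP[r0 r1] /=; rewrite min_r// max_r. Qed.

Lemma i01_inj s t : s%:num = t%:num -> s = t.
Proof. exact: val_inj. Qed.

Definition lam t := clamp (t%:num / 2).
Definition rho t := clamp ((t%:num + 1) / 2).

Lemma lamE t : (lam t)%:num = t%:num / 2.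
Proof. by rewrite clampE//; have := i01_bounds t; lra. Qed.

Lemma rhoE t : (rho t)%:num = (t%:num + 1) / 2.
Proof. by rewrite clampE//; have := i01_bounds t; lra. Qed.

Lemma lam_inj : injective lam.
Proof.
by move=> s t /(congr1 (fun u => u%:num)); rewrite !lamE => e; apply: i01_inj; lra.
Qed.

Lemma rho_inj : injective rho.
Proof.
by move=> s t /(congr1 (fun u => u%:num)); rewrite !rhoE => e; apply: i01_inj; lra.
Qed.

Lemma i01_leE s t : (s <= t) = (s%:num <= t%:num). Proof. by []. Qed.
Lemma i01_ltE s t : (s < t) = (s%:num < t%:num). Proof. by []. Qed.

Lemma lam_le s t : (lam s <= lam t) = (s <= t).
Proof. by rewrite !i01_leE !lamE; apply/idP/idP; lra. Qed.
Lemma rho_le s t : (rho s <= rho t) = (s <= t).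
Proof. by rewrite !i01_leE !rhoE; apply/idP/idP; lra. Qed.
Lemma lam_lt s t : (lam s < lam t) = (s < t).
Proof. by rewrite !i01_ltE !lamE; apply/idP/idP; lra. Qed.
Lemma rho_lt s t : (rho s < rho t) = (s < t).
Proof. by rewrite !i01_ltE !rhoE; apply/idP/idP; lra. Qed.

Lemma lam0 : lam 0%:i01 = 0%:i01.
Proof. by apply: i01_inj; rewrite lamE mul0r. Qed.
Lemma rho1 : rho 1%:i01 = 1%:i01.
Proof. by apply: i01_inj; rewrite rhoE /=; lra. Qed.
Lemma rho0 : rho 0%:i01 = lam 1%:i01.
Proof. by apply: i01_inj; rewrite rhoE lamE /=; lra. Qed.

Lemma lam_onto t : t%:num <= 2^-1 -> exists s, t = lam s.
Proof.
move=> t2; exists (clamp (2 * t%:num)); apply: i01_inj.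
by rewrite lamE clampE; have := i01_bounds t; lra.
Qed.

Lemma rho_onto t : 2^-1 <= t%:num -> exists s, t = rho s.
Proof.
move=> t2; exists (clamp (2 * t%:num - 1)); apply: i01_inj.
by rewrite rhoE clampE; have := i01_bounds t; lra.
Qed.

Variant half_spec : I -> Prop :=
| HalfLam s : half_spec (lam s)
| HalfRho s : half_spec (rho s).

Lemma halfP t : half_spec t.
Proof.
by have [/lam_onto|/ltW/rho_onto] := leP t%:num 2^-1 => -[s ->]; constructor.
Qed.

Lemma half_ext f g : (forall t, f (lam t) = g (lam t)) ->
  (forall t, f (rho t) = g (rho t)) -> f = g.
Proof. by move=> fl fr; apply/funext => t; case: (halfP t). Qed.

(** The midpoint takes its value from [f], so [glue_rho] requires [f 1 = g 0], which is continuity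
    there. *)
Definition glue f g t :=
  if t%:num <= 2^-1 then f (clamp (2 * t%:num)) else g (clamp (2 * t%:num - 1)).

Lemma glue_lam f g t : glue f g (lam t) = f t.
Proof.
rewrite /glue lamE ifT; last by have := i01_bounds t; lra.
by congr f; apply: i01_inj; rewrite clampE; have := i01_bounds t; lra.
Qed.

Lemma glue_rho f g t : f 1%:i01 = g 0%:i01 -> glue f g (rho t) = g t.
Proof.
move=> fg; have [t0|t0] := eqVneq t%:num 0.
  by rewrite (_ : t = 0%:i01) ?rho0 ?glue_lam//; apply: i01_inj.
rewrite /glue rhoE ifF; last by apply: negbTE; have := i01_bounds t; lra.
by congr g; apply: i01_inj; rewrite clampE; have := i01_bounds t; lra.
Qed.

Lemma affine_everywhere h (k : int) a b :
  (forall s t, (h t)%:num - (h s)%:num = 2 ^ k * (t%:num - s%:num)) ->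
  affine_on h a b (2 ^ k).
Proof. by move=> hk s t _ _. Qed.

Lemma cpl2_lam : cpl2 lam.
Proof.
apply/cpl2P; exists [::] => // a b _ _; exists (- 1); apply: affine_everywhere => s t.
by rewrite !lamE -[2 ^ (- 1)]/(2^-1); lra.
Qed.

Lemma cpl2_rho : cpl2 rho.
Proof.
apply/cpl2P; exists [::] => // a b _ _; exists (- 1); apply: affine_everywhere => s t.
by rewrite !rhoE -[2 ^ (- 1)]/(2^-1); lra.
Qed.

Lemma dyadic_half (x : R) : dyadic x -> dyadic (x / 2).
Proof. by move=> /(dyadicZ (- 1)); rewrite mulrC. Qed.

Lemma dyadic_lam t : dyadic t%:num -> dyadic (lam t)%:num.
Proof. by rewrite lamE; exact: dyadic_half. Qed.

Lemma dyadic_rho t : dyadic t%:num -> dyadic (rho t)%:num.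
Proof. by rewrite rhoE => dt; apply/dyadic_half/dyadicD => //; exact: dyadic1. Qed.

Lemma exprz2S (k : int) : 2 ^ (k + 1) = 2 ^ k * 2 :> R.
Proof. by rewrite expfzDr ?pnatr_eq0. Qed.

Lemma affine_glue_lam f g a b (k : int) :
  affine_on f a b (2 ^ k) -> affine_on (glue f g) (lam a) (lam b) (2 ^ (k + 1)).
Proof.
move=> fk.
have lamP s : lam a <= s <= lam b -> exists2 s', s = lam s' & a <= s' <= b.
  move=> hs; have [|s' e] := @lam_onto s.
    by move: hs; rewrite !i01_leE !lamE; have := i01_bounds b; lra.
  by exists s' => //; move: hs; rewrite e !lam_le.
move=> _ _ /lamP[s -> hs] /lamP[t -> ht]; rewrite !glue_lam (fk s t)// !lamE.
by rewrite exprz2S; lra.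
Qed.

Lemma affine_glue_rho f g a b (k : int) : f 1%:i01 = g 0%:i01 ->
  affine_on g a b (2 ^ k) -> affine_on (glue f g) (rho a) (rho b) (2 ^ (k + 1)).
Proof.
move=> fg gk.
have rhoP s : rho a <= s <= rho b -> exists2 s', s = rho s' & a <= s' <= b.
  move=> hs; have [|s' e] := @rho_onto s.
    by move: hs; rewrite !i01_leE !rhoE; have := i01_bounds a; lra.
  by exists s' => //; move: hs; rewrite e !rho_le.
move=> _ _ /rhoP[s -> hs] /rhoP[t -> ht]; rewrite !glue_rho// (gk s t)// !rhoE.
by rewrite exprz2S; lra.
Qed.

Lemma dyadic_half1 : dyadic (lam 1%:i01)%:num.
Proof. by apply: dyadic_lam; exact: dyadic1. Qed.

Lemma cpl2_glue f g : f 1%:i01 = g 0%:i01 -> cpl2 f -> cpl2 g -> cpl2 (glue f g).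
Proof.
move=> fg /cpl2P[p pd fp] /cpl2P[q qd gq]; apply/cpl2P.
exists (lam 1%:i01 :: map lam p ++ map rho q) => [t|a b ab].
  rewrite inE mem_cat => /or3P[/eqP->|/mapP[s /pd ds ->]|/mapP[s /qd ds ->]].
  - exact: dyadic_half1.
  - exact: dyadic_lam.
  - exact: dyadic_rho.
move=> /avoids_cons[ab1 abpq]; have half1 : (lam 1%:i01)%:num = 2^-1 by rewrite lamE div1r.
have [b1|b1] := leP b (lam 1%:i01).
  have [|b' be] := @lam_onto b; first by rewrite -half1.
  have [|a' ae] := @lam_onto a; first by rewrite -half1; apply: le_trans (ltW ab) b1.
  subst a b; have [||k fk] := fp a' b'; first by rewrite -lam_lt.
    move=> t tp; have := abpq (lam t); rewrite !lam_lt; apply.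
    by rewrite mem_cat map_f.
  by exists (k + 1); exact: affine_glue_lam.
have a1 : lam 1%:i01 <= a by rewrite leNgt; apply: contra ab1 => ->.
have [|a' ae] := @rho_onto a; first by rewrite -half1.
have [|b' be] := @rho_onto b; first by rewrite -half1 ltW.
subst a b; have [||k gk] := gq a' b'; first by rewrite -rho_lt.
  move=> t tp; have := abpq (rho t); rewrite !rho_lt; apply.
  by rewrite mem_cat map_f ?orbT.
by exists (k + 1); exact: affine_glue_rho.
Qed.

(** An intermediate value theorem: on an affine piece the preimage is solved for, and at a
    breakpoint [c] the value [h c] decides the side. *)
Lemma cpl2_onto h u : cpl2 h -> h 0%:i01 <= u <= h 1%:i01 -> exists t, h t = u.
Proof.
move=> /cpl2P[p _ hp].
suff main a b : a < b -> h a <= u <= h b -> exists t, h t = u.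
  by apply: main; rewrite i01_ltE /=.
move: a b; apply: (@pieces_ind _ p) => [a b ab /(hp _ _ ab)[k hk]|a c b _ _ _ IH1 IH2].
  move=> /andP[]; rewrite le_eqVlt => /orP[/eqP<-|au]; first by exists a.
  rewrite le_eqVlt => /orP[/eqP->|ub]; first by exists b.
  by have [|t _ <-] := affine_onto ab _ hk au ub; [exact: exprz_gt0|exists t].
move=> /andP[au ub]; have [uc|/ltW cu] := leP u (h c).
  by apply: IH1; rewrite au.
by apply: IH2; rewrite cu.
Qed.

Lemma in_F_ends h : cpl2 h -> h 0%:i01 = 0%:i01 -> h 1%:i01 = 1%:i01 -> in_F h.
Proof.
move=> ch h0 h1; split=> //; first exact: cpl2_lt.
by move=> u; apply: cpl2_onto => //; rewrite h0 h1 i01_ge0 i01_le1.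
Qed.

Lemma in_Phi_lam : in_Phi lam.
Proof.
by split; [exact: cpl2_lam|apply: dyadic_lam; exact: dyadic0|exact: dyadic_half1].
Qed.

Lemma in_Phi_rho : in_Phi rho.
Proof.
by split; [exact: cpl2_rho|apply: dyadic_rho; exact: dyadic0|
  apply: dyadic_rho; exact: dyadic1].
Qed.

Lemma in_Phi_compose h f : in_Phi h -> in_Phi f -> in_Phi (f \o h).
Proof.
move=> [ch d0 d1] [cf e0 e1]; split.
- exact: cpl2_comp.
- exact: (cpl2_dyadic cf e0 (h 0%:i01)).1.
- exact: (cpl2_dyadic cf e0 (h 1%:i01)).1.
Qed.

(** The breakpoints of [h] serve for [f], with every exponent of a slope raised by one. *)
Lemma cpl2_unscale h f : (forall s t, (h t)%:num - (h s)%:num =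
  2^-1 * ((f t)%:num - (f s)%:num)) -> cpl2 h -> cpl2 f.
Proof.
move=> hf /cpl2P[p pd hp]; apply/cpl2P; exists p => // a b ab /(hp _ _ ab)[k hk].
exists (k + 1) => s t hs ht; rewrite exprz2S.
by have := hk s t hs ht; rewrite hf => e; lra.
Qed.

Lemma cpl2_unlam f : cpl2 (lam \o f) -> cpl2 f.
Proof. by apply: cpl2_unscale => s t /=; rewrite !lamE; lra. Qed.

Lemma cpl2_unrho f : cpl2 (rho \o f) -> cpl2 f.
Proof. by apply: cpl2_unscale => s t /=; rewrite !rhoE; lra. Qed.

End Halves.

(** * Copies of F on the two halves and the standard generators *)

Section ThompsonElements.
Variable R : realType.
Local Notation F := (thompson R).
Local Notation I := {i01 R}.
Local Open Scope group_scope.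
Implicit Types (f g h : F) (s t : I).

Lemma th_ext f g : (forall t, f t = g t) -> f = g.
Proof. by move=> fg; apply: val_inj; apply/funext. Qed.

Lemma thM f g t : (f * g) t = g (f t). Proof. by []. Qed.

Lemma thK f t : f^-1 (f t) = t.
Proof. by rewrite -thM mulgV. Qed.
Lemma th_lt f s t : (f s < f t)%R = (s < t)%R.
Proof. by apply/leW_mono/le_mono; case: (thompson_in_F f). Qed.

Lemma th_fix0 f : f 0%:i01%R = 0%:i01%R.
Proof. exact/in_F_fix0/thompson_in_F. Qed.
Lemma th_fix1 f : f 1%:i01%R = 1%:i01%R.
Proof. exact/in_F_fix1/thompson_in_F. Qed.
Lemma th_cpl2 f : cpl2 f. Proof. by case: (thompson_in_F f). Qed.

Lemma th_half_ext f g : (forall t, f (lam t) = g (lam t)) ->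
  (forall t, f (rho t) = g (rho t)) -> f = g.
Proof. by move=> fl fr; apply: val_inj; apply: half_ext. Qed.

Lemma copyL_subproof f : in_F (glue (@lam R \o f) (@rho R)).
Proof.
have fg : lam (f 1%:i01%R) = rho 0%:i01%R :> I by rewrite th_fix1 rho0.
apply: in_F_ends.
- apply: cpl2_glue => //; last exact: cpl2_rho.
  apply: cpl2_comp; [exact: th_cpl2| |exact: cpl2_lam].
  by rewrite th_fix0; exact: dyadic0.
- by rewrite -{1}lam0 glue_lam /= th_fix0 lam0.
- by rewrite -{1}rho1 glue_rho// rho1.
Qed.

Lemma copyR_subproof f : in_F (glue (@lam R) (@rho R \o f)).
Proof.
have fg : lam 1%:i01%R = rho (f 0%:i01%R) :> I by rewrite th_fix0 rho0.
apply: in_F_ends.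
- apply: cpl2_glue => //; first exact: cpl2_lam.
  apply: cpl2_comp; [exact: th_cpl2| |exact: cpl2_rho].
  by rewrite th_fix0; exact: dyadic0.
- by rewrite -{1}lam0 glue_lam /= lam0.
- by rewrite -{1}rho1 glue_rho// /= th_fix1 rho1.
Qed.

Definition copyL f : F := MkThompson (asboolT (copyL_subproof f)).
Definition copyR f : F := MkThompson (asboolT (copyR_subproof f)).

Lemma copyL_lam f t : copyL f (lam t) = lam (f t).
Proof. by rewrite /= glue_lam. Qed.
Lemma copyL_rho f t : copyL f (rho t) = rho t.
Proof. by rewrite /= glue_rho//= th_fix1 rho0. Qed.
Lemma copyR_lam f t : copyR f (lam t) = lam t.
Proof. by rewrite /= glue_lam. Qed.
Lemma copyR_rho f t : copyR f (rho t) = rho (f t).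
Proof. by rewrite /= glue_rho//= th_fix0 rho0. Qed.

Lemma shrink_subproof : in_F (glue (@lam R \o @lam R)
  (glue (@lam R \o @rho R) (@rho R))).
Proof.
have e1 : lam (rho 1%:i01%R) = rho 0%:i01%R :> I by rewrite rho1 rho0.
have e0 : lam (lam 1%:i01%R) = glue (@lam R \o @rho R) (@rho R) 0%:i01%R.
  by rewrite -[X in glue _ _ X]lam0 glue_lam /= rho0.
have d0 (h : I -> I) : in_Phi h -> dyadic (h 0%:i01%R)%:num%R by case.
apply: in_F_ends.
- apply: cpl2_glue => //.
    apply: cpl2_comp (cpl2_lam R) _ (cpl2_lam R); exact: d0 (in_Phi_lam R).
  apply: cpl2_glue => //; last exact: cpl2_rho.
  apply: cpl2_comp (cpl2_rho R) _ (cpl2_lam R); exact: d0 (in_Phi_rho R).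
- by rewrite -{1}lam0 glue_lam /= !lam0.
- by rewrite -{1}rho1 glue_rho// -{1}rho1 glue_rho// rho1.
Qed.

(** The standard generator x_0 of F: it takes the leaves of the right comb with three leaves to
    those of the left comb, with slopes 1/2, 1, 2. *)
Definition shrink : F := MkThompson (asboolT shrink_subproof).

Lemma shrink_lam t : shrink (lam t) = lam (lam t).
Proof. by rewrite /= glue_lam. Qed.

Lemma shrink_rho_glue t : shrink (rho t) = glue (@lam R \o @rho R) (@rho R) t.
Proof. by rewrite /= glue_rho//= -[X in glue _ _ X]lam0 glue_lam /= rho0. Qed.

Lemma shrink_rholam t : shrink (rho (lam t)) = lam (rho t).
Proof. by rewrite shrink_rho_glue glue_lam. Qed.

Lemma shrink_rhorho t : shrink (rho (rho t)) = rho t.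
Proof. by rewrite shrink_rho_glue glue_rho//= rho1 rho0. Qed.

Definition thE :=
  (thM, copyL_lam, copyL_rho, copyR_lam, copyR_rho, shrink_lam, shrink_rholam,
   shrink_rhorho).

Lemma copyLM f g : copyL (f * g) = copyL f * copyL g.
Proof. by apply: th_half_ext => t; rewrite !thE. Qed.
Lemma copyRM f g : copyR (f * g) = copyR f * copyR g.
Proof. by apply: th_half_ext => t; rewrite !thE. Qed.

Lemma copyL1 : copyL 1 = 1.
Proof. by apply: (mulgI (copyL 1)); rewrite -copyLM !mulg1. Qed.
Lemma copyR1 : copyR 1 = 1.
Proof. by apply: (mulgI (copyR 1)); rewrite -copyRM !mulg1. Qed.
Lemma copyLV f : copyL f^-1 = (copyL f)^-1.
Proof. by apply: (mulgI (copyL f)); rewrite -copyLM !mulgV copyL1. Qed.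
Lemma copyRV f : copyR f^-1 = (copyR f)^-1.
Proof. by apply: (mulgI (copyR f)); rewrite -copyRM !mulgV copyR1. Qed.

(** [shrink] stretches the last quarter onto the right half, so a map supported on the right half
    pulls back to one supported on the last quarter. *)
Lemma shrink_copyR f : shrink * copyR f = copyR (copyR f) * shrink.
Proof.
apply: th_half_ext => t; first by rewrite !thE.
by case: (halfP t) => s; rewrite !thE.
Qed.

Lemma shrink_copyL_copyR f :
  shrink * copyL (copyR f) = copyR (copyL f) * shrink.
Proof.
apply: th_half_ext => t; first by rewrite !thE.
by case: (halfP t) => s; rewrite !thE.
Qed.

(** The standard infinite generating family, a_k in the overview; [shrink_at k] is the identity up
    to 1 - 2^-k. *)
Definition shrink_at k : F := iter k copyR shrink.

Lemma shrink_atS k : shrink_at k.+1 = copyR (shrink_at k).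
Proof. by []. Qed.

Lemma shrink_at_rel p k : p < k ->
  shrink_at p * shrink_at k = shrink_at k.+1 * shrink_at p.
Proof.
elim: p k => [|p IHp] [|k]//; first by move=> _; exact: shrink_copyR.
by rewrite ltnS => pk; rewrite /= -!copyRM IHp.
Qed.

(** The pentagon relation: both sides rotate the right comb with four leaves into the left comb. *)
Lemma copyL_shrink0 :
  shrink_at 1 * shrink * copyL shrink = shrink * shrink.
Proof.
apply: th_half_ext => t; first by rewrite !thE.
case: (halfP t) => s; rewrite !thE//.
by case: (halfP s) => s'; rewrite !thE.
Qed.

Fixpoint comb_map k : F := if k is k'.+1 then copyR (comb_map k') * shrink else 1.

(* [comb_map k.+1] rotates the right comb with [k + 3] leaves onto the tree
   whose left half carries [k + 2] of them. *)
Lemma copyL_shrink_at k : shrink_at k.+1 * comb_map k.+1 * copyL (shrink_at k) =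
  shrink_at k * comb_map k.+1.
Proof.
elim: k => [|k IHk]; first by rewrite /= copyR1 mul1g copyL_shrink0.
rewrite -[comb_map k.+2]/(copyR (comb_map k.+1) * shrink).
(* The factor [copyL (copyR _)] crosses [shrink] and becomes [copyR (copyL _)]; what precedes
   [shrink] is then the right copy of the induction hypothesis. *)
rewrite [copyL _]/= -!mulgA shrink_copyL_copyR !mulgA.
rewrite -[shrink_at k.+2]/(copyR (shrink_at k.+1)) -!copyRM IHk.
by rewrite copyRM.
Qed.

(** By monotonicity each half is invariant once the midpoint is fixed; [f0] and [f1] are the
    rescaled restrictions. *)
Lemma half_split f : f (lam 1%:i01%R) = lam 1%:i01%R ->
  exists f0 f1 : F, f = copyL f0 * copyR f1.
Proof.
move=> fh.
pose f0 t := clamp (2 * (f (lam t))%:num)%R; pose f1 t := clamp (2 * (f (rho t))%:num - 1)%R.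
have fle s t : (f s <= f t)%R = (s <= t)%R by rewrite !leNgt th_lt.
have half1 : ((lam 1%:i01)%:num = 2^-1 :> R)%R by rewrite lamE div1r.
have f0E t : f (lam t) = lam (f0 t).
  apply: i01_inj; rewrite lamE clampE; first by lra.
  have : (f (lam t) <= f (lam 1%:i01))%R by rewrite fle lam_le i01_le1.
  by rewrite fh i01_leE half1; have := i01_bounds (f (lam t)); lra.
have f1E t : f (rho t) = rho (f1 t).
  apply: i01_inj; rewrite rhoE clampE; first by lra.
  have : (f (rho 0%:i01) <= f (rho t))%R by rewrite fle rho_le i01_ge0.
  by rewrite rho0 fh i01_leE half1; have := i01_bounds (f (rho t)); lra.
have cf (h : I -> I) : in_Phi h -> cpl2 (f \o h).
  by move=> [ch h0 _]; apply: cpl2_comp => //; exact: th_cpl2.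
have F0 : in_F f0.
  apply: in_F_ends.
  - apply: cpl2_unlam; have := cf _ (in_Phi_lam R).
    by congr cpl2; apply/funext => t; exact: f0E.
  - by apply: (@lam_inj R); rewrite -f0E lam0 th_fix0.
  - by apply: (@lam_inj R); rewrite -f0E fh.
have F1 : in_F f1.
  apply: in_F_ends.
  - apply: cpl2_unrho; have := cf _ (in_Phi_rho R).
    by congr cpl2; apply/funext => t; exact: f1E.
  - by apply: (@rho_inj R); rewrite -f1E rho0 fh.
  - by apply: (@rho_inj R); rewrite -f1E rho1 th_fix1.
exists (MkThompson (asboolT F0)), (MkThompson (asboolT F1)).
by apply: th_half_ext => t; rewrite !thE.
Qed.

End ThompsonElements.

(** * Words in the generators of F and the functions they define *)

Section ThompsonRelations.
Local Open Scope group_scope.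

Definition thompson_rel (G : groupType) (x : nat -> G) :=
  forall p k, p < k -> x p * x k = x k.+1 * x p.

(** The head of the list is the rightmost factor, the last map applied. A letter multiplied on the
    right moves left past smaller letters, so lists sorted from the head are normal forms. *)
Fixpoint rprod (G : groupType) (x : nat -> G) s : G :=
  if s is i :: s' then rprod x s' * x i else 1.

Lemma rprod_cat (G : groupType) (x : nat -> G) s t :
  rprod x (s ++ t) = rprod x t * rprod x s.
Proof. by elim: s => [|i s IHs]; rewrite /= ?mulg1// IHs mulgA. Qed.

Fixpoint insert_letter i s :=
  if s is j :: s' then if i <= j then i :: s else j :: insert_letter i.+1 s'
  else [:: i].

Lemma insert_letter_sorted i j s :
  j <= i -> path leq j s -> path leq j (insert_letter i s).
Proof.
elim: s i j => [|k s IHs] i j ji /=; first by rewrite ji.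
move=> /andP[jk ks]; have [ik|ki] := leqP i k; rewrite /= ?ji ?ik ?jk//=.
by apply: IHs => //; rewrite leqW// ltnW.
Qed.

Lemma insert_letterE (G : groupType) (x : nat -> G) i s : thompson_rel x ->
  rprod x (insert_letter i s) = rprod x s * x i.
Proof.
move=> xrel; elim: s i => [|j s IHs] i //=; have [ij|ji] := leqP i j; first by [].
by rewrite /= IHs -!mulgA (xrel _ _ ji).
Qed.

(** Insertion sort, where a letter gains one each time it passes a smaller one. The same sorted word
    serves every group with the relations, so it can be compared in F and used elsewhere. *)
Lemma sort_letters s : exists2 s', sorted leq s' &
  forall (G : groupType) (x : nat -> G), thompson_rel x -> rprod x s' = rprod x s.
Proof.
elim: s => [|i s [s' s's s'E]]; first by exists [::].
exists (insert_letter i s') => [|G x xrel]; last first.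
  by rewrite insert_letterE//= s'E.
case: s' s's {s'E} => //= j s' js'; have [ij|ji] := leqP i j; rewrite /= ?ij//.
by apply: insert_letter_sorted js'; rewrite leqW// ltnW.
Qed.

(** The inverse letter moves left: it cancels against its own letter, and otherwise the larger of
    the two crossing indices grows by one. [N] and [P] do not depend on the group. *)
Lemma fraction_swap s i : exists N P,
  forall (G : groupType) (x : nat -> G), thompson_rel x ->
    rprod x s * (x i)^-1 = (rprod x N)^-1 * rprod x P.
Proof.
elim: s i => [|j s IHs] i.
  by exists [:: i], [::] => G x _; rewrite /= !mul1g mulg1.
have [ij|ji|ij] := ltngtP i j; last first.
- by exists [::], s => G x _; rewrite /= ij mulgK invg1 mul1g.
- have [N [P NP]] := IHs i.+1; exists N, (j :: P) => G x xrel.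
  rewrite /= mulgA -NP// -!mulgA; congr (_ * _).
  by rewrite -(mul_eq_div (xrel _ _ ji)).
- have [N [P NP]] := IHs i; exists N, (j.+1 :: P) => G x xrel.
  rewrite /= mulgA -NP// -!mulgA; congr (_ * _).
  by rewrite (mul_eq_div (esym (xrel _ _ ij))).
Qed.

End ThompsonRelations.

(** * Faithfulness: sorted words are determined by their functions *)

Section Faithful.
Variable R : realType.
Local Notation F := (thompson R).
Local Notation I := {i01 R}.
Local Notation xF := (@shrink_at R).
Local Open Scope group_scope.
Implicit Types (f : F) (t : I).

Lemma shrink_lt t : (0%:i01 < t)%R -> (t < 1%:i01)%R -> (shrink R t < t)%R.
Proof.
case: (halfP t) => s.
  by rewrite shrink_lam !i01_ltE !lamE /=; lra.
case: (halfP s) => {}s.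
  by rewrite shrink_rholam !i01_ltE !(lamE, rhoE); have := i01_bounds s; lra.
by rewrite shrink_rhorho !i01_ltE !rhoE /=; lra.
Qed.

(** The point 1 - 2^-j. *)
Definition knot j : I := iter j (@rho R) 0%:i01%R.

Lemma knot_lt1 j : (knot j < 1%:i01)%R.
Proof.
elim: j => [|j IHj]; first by rewrite i01_ltE /=.
by rewrite -[1%:i01%R]rho1 /= rho_lt.
Qed.

Lemma knot_lt j : (knot j < knot j.+1)%R.
Proof.
elim: j => [|j IHj]; first by rewrite i01_ltE rhoE /=; lra.
by rewrite /= rho_lt.
Qed.

Lemma shrink_at_fix j k : j <= k -> xF k (knot j) = knot j.
Proof.
elim: k j => [|k IHk] [|j]//; rewrite ?th_fix0//.
by rewrite ltnS => jk; rewrite copyR_rho IHk.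
Qed.

Lemma shrink_at_lt k t : (knot k < t)%R -> (t < 1%:i01)%R -> (xF k t < t)%R.
Proof.
elim: k t => [|k IHk] t; first exact: shrink_lt.
case: (halfP t) => s; last first.
  by rewrite shrink_atS copyR_rho -{1}[1%:i01%R]rho1 /knot iterS !rho_lt; exact: IHk.
move=> + _; rewrite i01_ltE /knot iterS rhoE lamE => h; exfalso; move: h.
by have := i01_bounds s; have := i01_bounds (knot k); lra.
Qed.

Lemma shrink_at_le k t : (xF k t <= t)%R.
Proof.
elim: k t => [|k IHk] t; last first.
  by rewrite shrink_atS; case: (halfP t) => s; rewrite ?copyR_lam ?copyR_rho ?rho_le.
have [t0|] := ltP 0%:i01%R t; last first.
  by move=> t0; rewrite (_ : t = 0%:i01%R) ?th_fix0//; apply/le_anti; rewrite t0 i01_ge0.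
have [t1|] := ltP t 1%:i01%R; first by apply/ltW/shrink_lt.
by move=> t1; rewrite (_ : t = 1%:i01%R) ?th_fix1//; apply/le_anti; rewrite t1 i01_le1.
Qed.

Lemma rprod_shrink_le s t : (rprod xF s t <= t)%R.
Proof.
elim: s t => [|i s IHs] t //; rewrite [rprod _ _]/= thM.
by apply: le_trans (IHs t); exact: shrink_at_le.
Qed.

Lemma rprod_shrink_fix j s : all (leq j) s -> rprod xF s (knot j) = knot j.
Proof.
elim: s => [|i s IHs] // /andP[ji /IHs e].
by rewrite [rprod _ _]/= thM e shrink_at_fix.
Qed.

(** The functions differ at [knot i.+1]: the letters of [s'] fix it, whereas the letters of [s] do
    not raise it and the final [xF i] strictly lowers every point between [knot i] and 1. *)
Lemma rprod_shrink_neq i s s' : all (leq i) s -> all (leq i.+1) s' ->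
  rprod xF (i :: s) <> rprod xF s'.
Proof.
move=> si s'i /(congr1 (fun f : F => f (knot i.+1))).
rewrite (rprod_shrink_fix s'i) [rprod _ _]/= thM => e.
have : (xF i (rprod xF s (knot i.+1)) < rprod xF s (knot i.+1))%R.
  apply: shrink_at_lt; first by rewrite -(rprod_shrink_fix si) th_lt knot_lt.
  by rewrite -(th_fix1 (rprod xF s)) th_lt knot_lt1.
move=> /lt_le_trans/(_ (rprod_shrink_le s _)).
by rewrite e ltxx.
Qed.

(** The heads are the least letters. Different heads are told apart by [rprod_shrink_neq]; equal
    heads cancel. *)
Lemma rprod_shrink_inj s s' : sorted leq s -> sorted leq s' ->
  rprod xF s = rprod xF s' -> s = s'.
Proof.
have le_all i u : path leq i u -> all (leq i) u by exact/order_path_min/leq_trans.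
have lt_all i j u : i < j -> path leq j u -> all (leq i.+1) (j :: u).
  move=> ij /le_all ju; rewrite /= ij /=; apply: sub_all ju => k.
  exact: leq_trans.
elim: s s' => [|i s IHs] [|j s']// hs hs'.
- by move=> /esym /(rprod_shrink_neq (le_all _ _ hs')); case.
- by move=> /(rprod_shrink_neq (le_all _ _ hs)); case.
have [ij|ji|<-] := ltngtP i j.
- by move=> /(rprod_shrink_neq (le_all _ _ hs)); case; apply: lt_all ij hs'.
- by move=> /esym /(rprod_shrink_neq (le_all _ _ hs')); case; apply: lt_all ji hs.
- by move=> /mulIg /(IHs _ (path_sorted hs) (path_sorted hs')) ->.
Qed.

Variables (G : groupType) (x : nat -> G).

(** [f] and [g] are spelled by one word in the generators and their inverses; a relation, because
    [f] has many spellings. *)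
Inductive lifts : F -> G -> Prop :=
| Lifts1 : lifts 1 1
| LiftsM i f g of lifts f g : lifts (f * xF i) (g * x i)
| LiftsV i f g of lifts f g : lifts (f * (xF i)^-1) (g * (x i)^-1).

Lemma lifts_gen i : lifts (xF i) (x i).
Proof. by rewrite -[xF i]mul1g -[x i]mul1g; do 2!constructor. Qed.

Lemma liftsM f g f' g' : lifts f g -> lifts f' g' -> lifts (f * f') (g * g').
Proof.
by move=> fg; elim=> [|i f2 g2 _|i f2 g2 _]; rewrite ?mulg1 ?mulgA => //; constructor.
Qed.

Lemma lifts_inv f g : lifts f g -> lifts f^-1 g^-1.
Proof.
elim=> [|i f2 g2 _ IH|i f2 g2 _ IH]; rewrite ?invg1 ?invgM ?invgK; first exact: Lifts1.
- by apply: liftsM IH; rewrite -[_^-1]mul1g -[(x i)^-1]mul1g; do 2!constructor.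
- by apply: liftsM IH; exact: lifts_gen.
Qed.

Hypothesis xrel : thompson_rel x.

Lemma lifts_fraction f g : lifts f g -> exists N P,
  f = (rprod xF N)^-1 * rprod xF P /\ g = (rprod x N)^-1 * rprod x P.
Proof.
have xFrel := @shrink_at_rel R.
elim=> [|i f2 g2 _ [N [P [-> ->]]]|i f2 g2 _ [N [P [-> ->]]]].
- by exists [::], [::]; rewrite /= !invg1 !mulg1.
- by exists N, (i :: P); rewrite /= !mulgA.
have [N' [P' NP]] := fraction_swap P i; exists (N ++ N'), P'.
by rewrite -!mulgA !NP// !rprod_cat !invgM !mulgA.
Qed.

(** The word becomes a fraction of positive words, and both are sorted. Triviality in F makes the
    two sorted lists equal, hence also their values in [G]. *)
Lemma lifts_faithful g : lifts 1 g -> g = 1.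
Proof.
move=> /lifts_fraction[N [P [/esym fE ->]]].
have [N' N's NE] := sort_letters N; have [P' P's PE] := sort_letters P.
suff -> : rprod x N = rprod x P by rewrite mulVg.
rewrite -NE// -PE//; congr rprod; apply: rprod_shrink_inj => //.
have xFrel := @shrink_at_rel R.
by rewrite NE// PE//; apply: (mulgI (rprod xF N)^-1); rewrite mulVg.
Qed.

Lemma lifts_uniq f g g' : lifts f g -> lifts f g' -> g = g'.
Proof.
move=> fg fg'; apply/divg1_eq/lifts_faithful.
by rewrite -(mulgV f); apply: liftsM => //; exact: lifts_inv.
Qed.

End Faithful.

(** * Binary trees and dyadic subdivisions *)

Lemma cat_inj (T : Type) (s1 s2 t1 t2 : seq T) : size s1 = size s2 ->
  s1 ++ t1 = s2 ++ t2 -> s1 = s2 /\ t1 = t2.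
Proof.
move=> s12 e; split.
  by move/(congr1 (take (size s1))): e; rewrite take_size_cat// take_size_cat.
by move/(congr1 (drop (size s1))): e; rewrite drop_size_cat// drop_size_cat.
Qed.

Inductive tree := Leaf | Node of tree & tree.

Fixpoint comb n := if n is n'.+1 then Node Leaf (comb n') else Leaf.
Fixpoint full n := if n is n'.+1 then Node (full n') (full n') else Leaf.

Section Trees.
Variable R : realType.
Local Notation F := (thompson R).
Local Notation I := {i01 R}.
Local Notation lam := (@lam R).
Local Notation rho := (@rho R).
Implicit Types (f g h : I -> I) (x y : I).

(** The intervals of the dyadic subdivision from left to right, each as its affine parametrization
    by the unit interval. *)
Fixpoint leaves t : seq (I -> I) :=
  if t is Node t1 t2 then
    [seq lam \o f | f <- leaves t1] ++ [seq rho \o f | f <- leaves t2]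
  else [:: id].

Lemma leaves_neq0 t : 0 < size (leaves t).
Proof. by elim: t => //= t1 IH1 t2 _; rewrite size_cat size_map ltn_addr. Qed.

Lemma size_comb n : size (leaves (comb n)) = n.+1.
Proof. by elim: n => //= n IHn; rewrite size_map IHn. Qed.

Lemma size_full n : size (leaves (full n)) = 2 ^ n.
Proof. by elim: n => //= n IHn; rewrite size_cat !size_map IHn expnS mul2n addnn. Qed.

Lemma leaves_ext (T : Type) (g h : I -> T) (t : tree) :
  [seq g \o f | f <- leaves t] = [seq h \o f | f <- leaves t] -> g = h.
Proof.
elim: t g h => [|t1 IH1 t2 IH2] g h /=; first by case.
rewrite !map_cat -!map_comp => /cat_inj[]; first by rewrite !size_map.
move=> /(IH1 (g \o lam) (h \o lam)) e1 /(IH2 (g \o rho) (h \o rho)) e2.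
apply/funext => x; case: (halfP x) => s.
  exact: (congr1 (fun k => k s) e1).
exact: (congr1 (fun k => k s) e2).
Qed.

Lemma leaves_head t : nth id (leaves t) 0 0%:i01%R = 0%:i01%R.
Proof.
elim: t => //= t1 IH1 t2 _.
by rewrite nth_cat size_map leaves_neq0 (nth_map id) ?leaves_neq0//= IH1 lam0.
Qed.

Lemma leaves_last t : nth id (leaves t) (size (leaves t)).-1 1%:i01%R = 1%:i01%R.
Proof.
elim: t => //= t1 _ t2 IH2.
have := leaves_neq0 t2; set n := size (leaves t2) in IH2 * => n0.
rewrite nth_cat size_cat !size_map -/n ifF; last by lia.
rewrite (_ : (_ - _)%N = n.-1); last by lia.
by rewrite (nth_map id) /= ?IH2 ?rho1// -/n; lia.
Qed.

Local Open Scope ring_scope.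

Lemma full_leafE n i x : (i < 2 ^ n)%N ->
  (nth id (leaves (full n)) i x)%:num = (i%:R + x%:num) / 2 ^+ n.
Proof.
elim: n i => [|n IHn] i; first by case: i => //= _; rewrite add0r expr0 divr1.
rewrite expnS mul2n -addnn => ilt /=.
have n0 : 2 ^+ n != 0 :> R by rewrite expf_neq0// pnatr_eq0.
rewrite nth_cat size_map size_full; have [ilo|ihi] := ltnP i (2 ^ n).
  rewrite (nth_map id) ?size_full//= lamE IHn// exprS.
  by field; rewrite ?n0.
have ilt' : (i - 2 ^ n < 2 ^ n)%N by lia.
rewrite (nth_map id) ?size_full//= rhoE IHn// natrB// exprS natrX.
by field; rewrite ?n0.
Qed.

(* On the tree [t], [h] maps every leaf interval affinely onto an interval of
   the uniform subdivision into [2 ^ n] parts. *)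
Definition fits h n (t : tree) pre := exists post,
  leaves (full n) = pre ++ [seq h \o f | f <- leaves t] ++ post.

(** [h 0] is the left end of the first leaf of the block and [h 1] the right end of the last; each
    leaf of [full n] has length 2^-n. *)
Lemma fits_bounds h n t pre : fits h n t pre ->
  (h 0%:i01)%:num = (size pre)%:R / 2 ^+ n /\
  (h 1%:i01)%:num = (size pre + size (leaves t))%:R / 2 ^+ n.
Proof.
move=> [post e]; have t0 := leaves_neq0 t.
have szE : (2 ^ n = size pre + (size (leaves t) + size post))%N.
  by rewrite -size_full e !size_cat size_map.
have nthE i : (i < size (leaves t))%N ->
    nth id (leaves (full n)) (size pre + i) = h \o nth id (leaves t) i.
  move=> it; rewrite e nth_cat ifF ?addKn; last by lia.
  by rewrite nth_cat size_map it (nth_map id).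
split.
  rewrite -{1}(leaves_head t) -[h _]/((h \o nth id (leaves t) 0) 0%:i01).
  by rewrite -nthE// full_leafE ?addn0 ?addr0//; lia.
rewrite -{1}(leaves_last t) -[h _]/((h \o nth id (leaves t) (size (leaves t)).-1) 1%:i01).
rewrite -nthE ?full_leafE; [|by lia..].
by congr (_ / _); rewrite /= natr1 -addnS prednK.
Qed.

(** Inductive form of piecewise linearity with dyadic breakpoints: finitely many halvings of the
    domain make [h] affine. *)
Inductive halving_affine h : Prop :=
| HalvingAffine (k : int) of
    (forall s t : I, (h t)%:num - (h s)%:num = 2 ^ k * (t%:num - s%:num))
| HalvingSplit of halving_affine (h \o lam) & halving_affine (h \o rho).

(** Induction on a common exponent [K] of the denominators of the breakpoints: rescaling a half to
    the unit interval lowers it by one. *)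
Lemma halving_affine_level K h (p : seq I) :
    (forall t, t \in p -> exists n : int, 2 ^+ K * t%:num = n%:~R) ->
    (forall a b, a < b -> avoids p a b -> exists k : int, affine_on h a b (2 ^ k)) ->
  halving_affine h.
Proof.
elim: K h p => [|K IHK] h p pK hp.
  have [||k hk] := hp 0%:i01 1%:i01; first by rewrite i01_ltE /=.
    move=> t /pK[n]; rewrite expr0 mul1r i01_ltE i01_ltE /= => ->.
    (* At level 0 breakpoints are integers, and none lies strictly between 0 and 1. *)
    by apply/negP; rewrite -[0]/(0%:~R) -[1]/(1%:~R) !ltr_int; lia.
  by apply: (@HalvingAffine _ k) => s t; apply: hk; rewrite i01_ge0 i01_le1.
have half_affine (j : I -> I) a b : (forall s t, (j s <= j t) = (s <= t)) ->
    (forall s t, (j t)%:num - (j s)%:num = 2^-1 * (t%:num - s%:num)) ->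
    (exists k : int, affine_on h (j a) (j b) (2 ^ k)) ->
    exists k : int, affine_on (h \o j) a b (2 ^ k).
  move=> jle jE [k hk]; exists (k - 1) => s t hs ht /=.
  rewrite (hk (j s) (j t)) ?jle// jE -[k in LHS](subrK 1 k) exprz2S.
  by lra.
have [p0 p0E] := Defs.preim_seq p (@lam_inj R).
have [p1 p1E] := Defs.preim_seq p (@rho_inj R).
apply: HalvingSplit; [apply: (IHK _ p0)|apply: (IHK _ p1)].
- move=> t; rewrite p0E => /pK[n]; rewrite lamE exprS => e.
  by exists n; rewrite -e; lra.
- move=> a b ab av; apply: (half_affine) => [s t|s t|]; first exact: lam_le.
    by rewrite !lamE; lra.
  apply: hp; first by rewrite lam_lt.
  move=> t tp; apply/negP => /andP[ta tb].
  have [|t' te] := @lam_onto _ t.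
    by move: tb; rewrite i01_ltE lamE; have := i01_bounds b; lra.
  by have := av t'; rewrite p0E -te tp -(lam_lt a) -(lam_lt t') -te ta tb => /(_ isT).
- move=> t; rewrite p1E => /pK[n]; rewrite rhoE exprS => e.
  by exists (n - 2 ^+ K); rewrite rmorphB /= -e rmorphXn /=; lra.
- move=> a b ab av; apply: (half_affine) => [s t|s t|]; first exact: rho_le.
    by rewrite !rhoE; lra.
  apply: hp; first by rewrite rho_lt.
  move=> t tp; apply/negP => /andP[ta tb].
  have [|t' te] := @rho_onto _ t.
    by move: ta; rewrite i01_ltE rhoE; have := i01_bounds a; lra.
  by have := av t'; rewrite p1E -te tp -(rho_lt a) -(rho_lt t') -te ta tb => /(_ isT).
Qed.

Lemma dyadic_common (p : seq I) : (forall t, t \in p -> dyadic t%:num) ->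
  exists K, forall t, t \in p -> exists n : int, 2 ^+ K * t%:num = n%:~R.
Proof.
elim: p => [|u p IHp] pd; first by exists 0%N.
have [t tp|K pK] := IHp; first by apply: pd; rewrite inE tp orbT.
have [m [j uE]] := pd u (mem_head _ _).
exists (K + j)%N => t; rewrite inE => /orP[/eqP ->|/pK[n e]].
  exists (2 ^+ K * m); rewrite uE exprD rmorphM rmorphXn /=; field.
  by rewrite expf_neq0// pnatr_eq0.
by exists (2 ^+ j * n); rewrite exprD rmorphM rmorphXn /= -e; ring.
Qed.

Lemma halving_affine_cpl2 h : cpl2 h -> halving_affine h.
Proof.
move=> /cpl2P[p /dyadic_common[K pK] hp]; exact: halving_affine_level pK hp.
Qed.

Lemma dyadic_nat (x : R) : 0 <= x -> dyadic x -> exists n k : nat, x = n%:R / 2 ^+ k.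
Proof.
move=> x0 [[n|n] [k e]]; first by exists n, k.
move: x0; rewrite e ler_pdivlMr ?exprn_gt0// mul0r.
by rewrite -[0]/(0%:~R) ler_int.
Qed.

Lemma fits_affine h (k : int) :
    (forall s t : I, (h t)%:num - (h s)%:num = 2 ^ k * (t%:num - s%:num)) ->
    dyadic (h 0%:i01)%:num ->
  exists n0, forall n, (n0 <= n)%N -> exists t pre, fits h n t pre.
Proof.
move=> hk d0; have h0 : 0 <= (h 0%:i01)%:num by exact: i01_ge0.
have [c [j cE]] := dyadic_nat h0 d0.
(* For such [n] the exponent m = n + k is natural and [h 0] is c' / 2^n, so [h] takes the 2^m leaves
   of [full m] to consecutive leaves of [full n], starting after the first c'. *)
exists (j + `|k|)%N => n jn.
have [m mE] : exists m : nat, m%:Z = n%:Z + k by exists (absz (n%:Z + k)); lia.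
pose c' := (c * 2 ^ (n - j))%N.
have n0 : 2 ^+ n != 0 :> R by rewrite expf_neq0// pnatr_eq0.
have m0 : 2 ^+ m != 0 :> R by rewrite expf_neq0// pnatr_eq0.
have j0 : 2 ^+ j != 0 :> R by rewrite expf_neq0// pnatr_eq0.
have kE : 2 ^ k = 2 ^+ m / 2 ^+ n :> R.
  rewrite (_ : k = m%:Z - n%:Z); last by lia.
  by rewrite expfzDr ?pnatr_eq0// -exprnN.
have hE x : (h x)%:num = (c'%:R + 2 ^+ m * x%:num) / 2 ^+ n.
  rewrite -[LHS](subrK (h 0%:i01)%:num) hk cE kE /= subr0 /c' natrM natrX.
  rewrite (_ : 2 ^+ n = 2 ^+ (n - j) * 2 ^+ j :> R); last first.
    by rewrite -exprD; congr (_ ^+ _); lia.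
  field; rewrite j0 expf_neq0// pnatr_eq0//.
have cm : (c' + 2 ^ m <= 2 ^ n)%N.
  have : (h 1%:i01)%:num <= 1 by exact: i01_le1.
  rewrite hE /= mulr1.
  rewrite ler_pdivrMr ?exprn_gt0// mul1r.
  by rewrite -!natrX -natrD ler_nat.
exists (full m), (take c' (leaves (full n))), (drop (c' + 2 ^ m) (leaves (full n))).
have -> : [seq h \o f | f <- leaves (full m)] = take (2 ^ m) (drop c' (leaves (full n))).
  apply: (@eq_from_nth _ id) => [|i].
    by rewrite size_map size_take size_drop !size_full; case: ifP; lia.
  rewrite size_map size_full => im; rewrite (nth_map id) ?size_full//.
  rewrite nth_take// nth_drop; apply/funext => x; apply: i01_inj.
  rewrite /= hE !full_leafE//; last by lia.
  by rewrite natrD; field; rewrite n0 m0.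
by rewrite addnC -drop_drop cat_take_drop cat_take_drop.
Qed.

(** As [h (lam 1) = h (rho 0)], the second block starts where the first ends, and the blocks
    concatenate. *)
Lemma fits_split h n t1 t2 pre1 pre2 :
  fits (h \o lam) n t1 pre1 -> fits (h \o rho) n t2 pre2 ->
  fits h n (Node t1 t2) pre1.
Proof.
move=> f1 f2; have [[_ b1] [b2 _]] := (fits_bounds f1, fits_bounds f2).
have n0 : 2 ^+ n != 0 :> R by rewrite expf_neq0// pnatr_eq0.
have szE : (size pre2 = size pre1 + size (leaves t1))%N.
  apply/eqP; rewrite -(eqr_nat R); apply/eqP; apply: (mulIf (invr_neq0 n0)).
  by rewrite -b1 -b2 /= rho0.
move: f1 f2 => [post1 e1] [post2]; rewrite e1 catA => e2.
have [|e _] := cat_inj _ e2; first by rewrite size_cat size_map szE.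
exists post2; move: e2; rewrite -catA -e1 => ->.
by rewrite -e /= map_cat -!map_comp -!catA.
Qed.

Lemma halving_affine_fits h : halving_affine h ->
    (forall x, dyadic x%:num -> dyadic (h x)%:num) ->
  exists n0, forall n, (n0 <= n)%N -> exists t pre, fits h n t pre.
Proof.
elim=> [{}h k hk hd|{}h _ IH1 _ IH2 hd].
  by apply: fits_affine hk _; apply: hd; exact: dyadic0.
have [x dx|n1 f1] := IH1; first exact/hd/dyadic_lam.
have [x dx|n2 f2] := IH2; first exact/hd/dyadic_rho.
exists (maxn n1 n2) => n; rewrite geq_max => /andP[/f1[t1 [pre1 ft1]] /f2[t2 [pre2 ft2]]].
by exists (Node t1 t2), pre1; exact: fits_split ft1 ft2.
Qed.

(** All large [n] are allowed so that two maps can be fitted to the same subdivision. *)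
Lemma in_Phi_fits h : in_Phi h ->
  exists n0, forall n, (n0 <= n)%N -> exists t pre, fits h n t pre.
Proof.
move=> [ch d0 _]; apply: halving_affine_fits (halving_affine_cpl2 ch) _ => x.
exact: (cpl2_dyadic ch d0 x).1.
Qed.

End Trees.

(** * Generators of F and transitivity on comb leaves *)

Section Generation.
Variable R : realType.
Local Notation F := (thompson R).
Local Notation I := {i01 R}.
Local Notation lam := (@lam R).
Local Notation rho := (@rho R).
Local Notation leaves := (@leaves R).
Local Open Scope group_scope.
Implicit Types (f g : F) (x : I).

(** Inductively [copyR (comb_map R p)] leads to [Node Leaf (Node (comb p) (comb q))], whose root
    [shrink] rotates. *)
Lemma comb_mapE p q : [seq comb_map R p \o l | l <- leaves (comb (p + q).+1)] =
  leaves (Node (comb p) (comb q)).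
Proof.
elim: p => [|p IHp]; first exact: map_id.
rewrite addSn -[leaves (comb _)]/(lam :: [seq rho \o l | l <- leaves (comb (p + q).+1)]).
rewrite map_cons -map_comp.
have -> : [seq ((fun l => comb_map R p.+1 \o l) \o (fun l => rho \o l)) l
    | l <- leaves (comb (p + q).+1)] =
    [seq (shrink R \o rho) \o l | l <- leaves (Node (comb p) (comb q))].
  rewrite -IHp -[RHS]map_comp; apply: eq_map => f; apply/funext => x.
  rewrite [comb_map _ _]/= /= -[LHS]/((copyR (comb_map R p) * shrink R) (rho (f x))).
  by rewrite thM copyR_rho.
rewrite [leaves (Node _ _)]/= map_cat -!map_comp /=; congr (_ :: _).
  apply/funext => x; rewrite -[LHS]/((copyR (comb_map R p) * shrink R) (lam x)).
  by rewrite thM copyR_lam shrink_lam.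
rewrite -!map_comp; congr (_ ++ _); apply: eq_map => f; apply/funext => x.
  exact: shrink_rholam.
exact: shrink_rhorho.
Qed.

(** Carries [t] to the right comb with as many leaves: the subtrees are straightened, then the two
    combs are joined into one. *)
Fixpoint straighten t : F :=
  if t is Node t1 t2 then
    copyL (straighten t1) * copyR (straighten t2) *
      (comb_map R (size (leaves t1)).-1)^-1
  else 1.

Lemma map_thM f g (s : seq (I -> I)) :
  [seq (f * g : F) \o h | h <- s] = [seq g \o h | h <- [seq f \o h | h <- s]].
Proof. by rewrite -map_comp; apply: eq_map => h. Qed.

Lemma map_thV f (s s' : seq (I -> I)) :
  [seq f \o h | h <- s] = s' -> [seq f^-1 \o h | h <- s'] = s.
Proof.
move=> <-; rewrite -map_thM mulgV; apply: map_id.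
Qed.

Lemma straightenE t : [seq straighten t \o l | l <- leaves t] =
  leaves (comb (size (leaves t)).-1).
Proof.
elim: t => [|t1 IH1 t2 IH2]; first exact: map_id.
have [n1 n2] := (leaves_neq0 R t1, leaves_neq0 R t2).
rewrite [straighten _]/= map_thM.
have -> : [seq (copyL (straighten t1) * copyR (straighten t2) : F) \o l
    | l <- leaves (Node t1 t2)] =
    leaves (Node (comb (size (leaves t1)).-1) (comb (size (leaves t2)).-1)).
  rewrite [leaves (Node t1 t2)]/= [RHS]/= -IH1 -IH2 map_cat -!map_comp.
  congr (_ ++ _); apply: eq_map => f; apply/funext => x /=.
    by rewrite -[LHS]/(copyR _ (copyL _ _)) copyL_lam copyR_lam.
  by rewrite -[LHS]/(copyR _ (copyL _ _)) copyL_rho copyR_rho.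
apply: map_thV; rewrite -comb_mapE; congr [seq _ | _ <- leaves (comb _)].
by rewrite /= size_cat !size_map -[in LHS](prednK n1) -[in LHS](prednK n2) addSn addnS.
Qed.

Lemma tree_map t t' : size (leaves t) = size (leaves t') ->
  [seq (straighten t * (straighten t')^-1 : F) \o l | l <- leaves t] = leaves t'.
Proof.
move=> tt'; rewrite map_thM straightenE tt'.
by apply: map_thV; rewrite straightenE.
Qed.

Inductive generated : F -> Prop :=
| Generated1 : generated 1
| GeneratedM f g of generated f & generated g : generated (f * g)
| GeneratedV f of generated f : generated f^-1
| GeneratedX k : generated (shrink_at R k).

Lemma generated_copyR f : generated f -> generated (copyR f).
Proof.
elim=> [|f1 g1 _ IHf _ IHg|f1 _ IHf|k]; rewrite ?copyR1 ?copyRM ?copyRV; try by constructor.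
exact: (GeneratedX k.+1).
Qed.

Lemma generated_comb k : generated (comb_map R k).
Proof.
elim: k => [|k IHk]; first exact: Generated1.
by apply: GeneratedM; [exact: generated_copyR|exact: (GeneratedX 0)].
Qed.

(** [copyL_shrink_at] is solved for the left copy of a generator. *)
Lemma generated_copyL f : generated f -> generated (copyL f).
Proof.
elim=> [|f1 g1 _ IHf _ IHg|f1 _ IHf|k]; rewrite ?copyL1 ?copyLM ?copyLV; try by constructor.
have e := copyL_shrink_at R k.
rewrite -(mulKg (shrink_at R k.+1 * comb_map R k.+1) (copyL _)) e.
by do ![exact: GeneratedX|exact: generated_comb|apply: GeneratedM|apply: GeneratedV].
Qed.

Lemma generated_straighten t : generated (straighten t).
Proof.
elim: t => [|t1 IH1 t2 IH2]; first exact: Generated1.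
apply: GeneratedM; last by apply/GeneratedV/generated_comb.
by apply: GeneratedM; [exact: generated_copyL|exact: generated_copyR].
Qed.

(** Since [f] fixes 0 and 1, it maps the leaves of some tree onto the whole uniform subdivision, as
    does a quotient of two straightening elements. *)
Lemma th_generated f : generated f.
Proof.
have [n0 fit] := in_Phi_fits (in_F_Phi (thompson_in_F f)).
have [t [pre ft]] := fit n0 (leqnn _).
have [b0 b1] := fits_bounds ft; case: ft => post e.
have pn (n : nat) : (2 ^+ n != 0 :> R)%R by rewrite expf_neq0// pnatr_eq0.
have pre0 : size pre = 0.
  apply/eqP; rewrite -(eqr_nat R); apply/eqP/(mulIf (invr_neq0 (pn n0))).
  by rewrite -b0 th_fix0 /= mul0r.
have tn : size (leaves t) = (2 ^ n0)%N.
  apply/eqP; rewrite -(eqr_nat R); apply/eqP/(mulIf (invr_neq0 (pn n0))).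
  by move: b1; rewrite pre0 add0n th_fix1 natrX divff// => <-.
have {}e : [seq f \o h | h <- leaves t] = leaves (full n0).
  have [||e' _] := @cat_inj _ [seq f \o h | h <- leaves t] (leaves (full n0)) post [::].
  - by rewrite size_map size_full.
  - by rewrite cats0 e; case: (pre) pre0.
  - by [].
suff -> : f = straighten t * (straighten (full n0))^-1.
  by apply: GeneratedM; [|apply: GeneratedV]; exact: generated_straighten.
apply: val_inj; apply: (@leaves_ext _ _ _ _ t).
by rewrite [LHS]e tree_map// size_full.
Qed.

(** The right comb with the trees of the list grafted on its leaves in order. *)
Fixpoint spine s :=
  match s with
  | [::] => Leaf
  | [:: t] => t
  | t :: s' => Node t (spine s')
  end.

(* [slot p true] parametrizes the [p]-th leaf of a right comb, unless it is the
   last leaf, which [slot p false] parametrizes. *)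
Definition slot p (b : bool) : I -> I := iter p (comp rho) (if b then lam else id).

Lemma slotS p b x : slot p.+1 b x = rho (slot p b x).
Proof. by []. Qed.

Lemma spine_cons t s : s <> [::] -> spine (t :: s) = Node t (spine s).
Proof. by case: s. Qed.

Definition weight s := sumn [seq size (leaves t) | t <- s].

Lemma weight_cat s s' : weight (s ++ s') = weight s + weight s'.
Proof. by rewrite /weight map_cat sumn_cat. Qed.

Lemma weight1 t : weight [:: t] = size (leaves t).
Proof. exact: addn0. Qed.

Lemma size_spine s : s <> [::] -> size (leaves (spine s)) = weight s.
Proof.
elim: s => // t [|t' s] IHs _; first by rewrite /weight /= addn0.
by rewrite spine_cons// /= size_cat !size_map IHs.
Qed.

Lemma spine_leaves s1 t s2 : exists A B,
  leaves (spine (s1 ++ t :: s2)) =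
    A ++ [seq slot (size s1) (0 < size s2) \o l | l <- leaves t] ++ B /\
  size A = weight s1.
Proof.
elim: s1 => [|t' s1 [A [B [e sA]]]].
  case: s2 => [|t' s2]; last first.
    by exists [::], [seq rho \o l | l <- leaves (spine (t' :: s2))].
  by exists [::], [::]; rewrite /= cats0; split=> //; rewrite map_id.
rewrite cat_cons spine_cons; last by case: (s1).
exists ([seq lam \o l | l <- leaves t'] ++ [seq rho \o l | l <- A]).
exists [seq rho \o l | l <- B]; split; last first.
  by rewrite size_cat !size_map sA.
by rewrite [LHS]/= e !map_cat -!map_comp -catA; congr (_ ++ (_ ++ (_ ++ _))).
Qed.

(** On the leaves of [t] both maps give the block of [full n] that follows the first [size pre]
    leaves. *)
Lemma fits_slot (h : I -> I) n pre t g s1 s2 : fits h n t pre ->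
    [seq g \o l | l <- leaves (spine (s1 ++ t :: s2))] = leaves (full n) ->
    size pre = weight s1 ->
  h = g \o slot (size s1) (0 < size s2).
Proof.
move=> [post ->]; have [A [B [-> sA]]] := spine_leaves s1 t s2.
rewrite !map_cat -map_comp => e pA.
have [|_ e2] := cat_inj _ e; first by rewrite size_map sA.
have [|e3 _] := cat_inj _ e2; first by rewrite !size_map.
by apply: (@leaves_ext _ _ _ _ t); rewrite -e3; apply: eq_map.
Qed.

(** Padding by [k] leaves; no tree at all for [k = 0], since every tree has a leaf. *)
Definition fill k := if k is k'.+1 then [:: comb k'] else [::].

Lemma weight_fill k : weight (fill k) = k.
Proof. by case: k => //= k; rewrite /weight /= size_comb addn0. Qed.

Lemma spine_full s n : weight s = (2 ^ n)%N -> exists g : F,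
  [seq g \o l | l <- leaves (spine s)] = leaves (full n).
Proof.
move=> sn; exists (straighten (spine s) * (straighten (full n))^-1).
apply: tree_map; rewrite size_full size_spine//.
by move=> s0; have := expn_gt0 2 n; rewrite -sn s0.
Qed.

Lemma fits_size (h : I -> I) n t pre : fits h n t pre ->
  size pre + size (leaves t) <= (2 ^ n)%N.
Proof. by move=> [post e]; rewrite -(size_full R) e !size_cat size_map; lia. Qed.

(** The fitted tree is padded on both sides to 2^n leaves; [g] carries the resulting spine to the
    uniform subdivision. *)
Lemma Phi_slot (h : I -> I) : in_Phi h -> exists (g : F) p b, h = g \o slot p b.
Proof.
move=> /in_Phi_fits[n /(_ n (leqnn n))[t [pre ht]]]; have := fits_size ht => htn.
have [|g gE] := @spine_full
    (fill (size pre) ++ t :: fill ((2 ^ n)%N - (size pre + size (leaves t)))) n.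
  by rewrite -(cat1s t) !weight_cat !weight_fill weight1; lia.
exists g; do 2!eexists; apply: fits_slot ht gE _.
by rewrite weight_fill.
Qed.

(** Both trees go on one spine, padded before, between and after; the first is never the last leaf
    of the comb, hence [true]. *)
Lemma Phi_slot2 (h1 h2 : I -> I) : in_Phi h1 -> in_Phi h2 ->
    (h1 1%:i01 <= h2 0%:i01)%R ->
  exists (g : F) p1 p2 b, [/\ p1 < p2, h1 = g \o slot p1 true & h2 = g \o slot p2 b].
Proof.
move=> /in_Phi_fits[n1 fit1] /in_Phi_fits[n2 fit2] h12.
have [t1 [pre1 ht1]] := fit1 (maxn n1 n2) (leq_maxl _ _).
have [t2 [pre2 ht2]] := fit2 (maxn n1 n2) (leq_maxr _ _).
move: {fit1 fit2} (maxn n1 n2) ht1 ht2 => n ht1 ht2.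
have [_ b1] := fits_bounds ht1; have [b2 _] := fits_bounds ht2.
have pre12 : size pre1 + size (leaves t1) <= size pre2.
  rewrite -(ler_nat R); move: h12; rewrite i01_leE b1 b2.
  by rewrite ler_pM2r// invr_gt0 exprn_gt0.
pose mid := fill (size pre2 - (size pre1 + size (leaves t1))).
pose post := fill ((2 ^ n)%N - (size pre2 + size (leaves t2))).
have tn2 := fits_size ht2.
have [|g gE] := @spine_full (fill (size pre1) ++ t1 :: mid ++ t2 :: post) n.
  by rewrite -(cat1s t1) -(cat1s t2) !weight_cat !weight_fill !weight1; lia.
exists g, (size (fill (size pre1))), (size (fill (size pre1) ++ t1 :: mid)), (0 < size post).
split; first by rewrite size_cat /= addnS ltnS leq_addr.
  rewrite (fits_slot ht1 gE) ?weight_fill//.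
  by rewrite size_cat /= addnS.
apply: (fits_slot ht2); first by rewrite -catA.
by rewrite -(cat1s t1) !weight_cat !weight_fill weight1; lia.
Qed.

End Generation.

(** * The action of F on the partially commutative group *)

Section DisjointImages.
Variable R : realType.
Local Open Scope ring_scope.
Local Open Scope classical_set_scope.
Implicit Types (h : Phi R) (g : thompson R).

Lemma Phi_le h : {mono h : s t / s <= t}.
Proof. by apply/le_mono/cpl2_lt; case: (Phi_in h). Qed.

Lemma Phi_imageE h :
  Phi_image h = [set` `[(h 0%:i01)%:num, (h 1%:i01)%:num]%R].
Proof.
have hle (s t : {i01 R}) : s <= t -> (h s)%:num <= (h t)%:num.
  by rewrite -(Phi_le h) i01_leE.
apply/seteqP; split => [_ [t _ <-]|r].
  by rewrite /= in_itv /= !hle ?i01_ge0 ?i01_le1.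
rewrite /= in_itv /= => /andP[h0 h1].
have r01 : 0 <= r <= 1.
  by rewrite (le_trans _ h0) ?(le_trans h1).
have [ch _ _] := Phi_in h; have [|t te] := cpl2_onto (u := clamp r) ch.
  by rewrite !i01_leE clampE// h0 h1.
by exists t => //; rewrite te clampE.
Qed.

Lemma disjoint_imagesP h1 h2 : disjoint_images h1 h2 <->
  h1 1%:i01 <= h2 0%:i01 \/ h2 1%:i01 <= h1 0%:i01.
Proof.
have end_lt h : (h 0%:i01)%:num < (h 1%:i01)%:num.
  by rewrite -i01_ltE (leW_mono (Phi_le h)) i01_ltE /=.
have [l1 l2] := (end_lt h1, end_lt h2).
rewrite /disjoint_images !Phi_imageE !interior_itv_bnd !i01_leE.
split=> [/seteqP[sub _]|dis].
  have [|lt12] := leP (h1 1%:i01)%:num (h2 0%:i01)%:num; first by left.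
  have [|lt21] := leP (h2 1%:i01)%:num (h1 0%:i01)%:num; first by right.
  move: l1 l2 lt12 lt21 sub; set a := (h1 0%:i01)%:num; set b := (h1 1%:i01)%:num.
  set c := (h2 0%:i01)%:num; set d := (h2 1%:i01)%:num => ab cd cb ad.
  (* The midpoint of the overlap lies in both interiors. *)
  move=> /(_ ((Order.max a c + Order.min b d) / 2)) /=; case.
  by rewrite !in_itv /=; split; case: (leP a c); case: (leP b d) => ? ?; lra.
by apply/seteqP; split => // r /= []; rewrite !in_itv /=; case: dis; lra.
Qed.

Lemma disjoint_images_mul h1 h2 g : disjoint_images h1 h2 ->
  disjoint_images (Phi_mul h1 g) (Phi_mul h2 g).
Proof.
have gle : {mono g : s t / s <= t} by apply/le_mono => s t; rewrite th_lt.
by move=> /disjoint_imagesP dis; apply/disjoint_imagesP; rewrite /= !gle.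
Qed.

End DisjointImages.

Section Action.
Variable R : realType.
Local Notation F := (thompson R).
Local Notation A := (groupA R).
Local Open Scope group_scope.
Implicit Types (h : Phi R) (g : F).

Lemma groupA_lift (K : groupType) (v : Phi R -> K) :
    (forall h1 h2, disjoint_images h1 h2 -> commute (v h1) (v h2)) ->
  exists phi : {multiplicative A -> K}, forall h, phi (alpha h) = v h.
Proof.
move=> vcomm; apply: pres_lift => r [h1 [h2 [/vcomm h12 ->]]].
rewrite !big_cons big_nil /letter /= mulg1.
by rewrite h12 mulKg mulVg.
Qed.

Lemma groupA_ind (P : A -> Prop) :
    P 1 -> (forall a b, P a -> P b -> P (a * b)) -> (forall a, P a -> P a^-1) ->
    (forall h, P (alpha h)) -> forall a, P a.
Proof. exact: pres_ind. Qed.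

Lemma alpha_commute h1 h2 :
  disjoint_images h1 h2 -> commute (alpha h1) (alpha h2).
Proof.
exact: pc_gen_commute.
Qed.

(** Composition with [g] sends generators to generators and keeps images disjoint; the laws of an
    action are checked on generators. *)
Lemma act_exists : exists act : aut_action A F,
  forall h g, act (alpha h) g = alpha (Phi_mul h g).
Proof.
have H g : exists phi : {multiplicative A -> A},
    forall h, phi (alpha h) = alpha (Phi_mul h g).
  by apply: groupA_lift => h1 h2 /(disjoint_images_mul g)/alpha_commute.
pose act g := projT1 (cid (H g)).
have actX g h : act g (alpha h) = alpha (Phi_mul h g) by rewrite /act; case: cid.
have act1 a : act 1 a = a.
  elim/groupA_ind: a => [|a b IHa IHb|a IHa|h].
  - exact: mult1.
  - by rewrite gmulfM IHa IHb.
  - by rewrite multV IHa.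
  - by rewrite actX; congr alpha; apply: val_inj.
have actM a f g : act (f * g) a = act g (act f a).
  elim/groupA_ind: a => [|a b IHa IHb|a IHa|h].
  - by rewrite !mult1.
  - by rewrite !gmulfM IHa IHb.
  - by rewrite !multV IHa.
  - by rewrite !actX; congr alpha; apply: val_inj.
have act_mul a b f : act f (a * b) = act f a * act f b by rewrite gmulfM.
exists (@AutAction A F (fun a g => act g a) act1 actM act_mul) => h g; exact: actX.
Qed.

End Action.

(** * The inverse homomorphism *)

Section Slots.
Variable R : realType.
Local Notation F := (thompson R).
Local Notation I := {i01 R}.
Local Notation slot := (@slot R).
Local Open Scope group_scope.
Implicit Types (f g : F) (t : I).

Lemma slot_shrink p k b t : p < k -> shrink_at R p (slot k.+1 b t) = slot k b t.
Proof.
elim: p k => [|p IHp] [|k] //; first by move=> _; exact: shrink_rhorho.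
by rewrite ltnS shrink_atS slotS copyR_rho => /IHp ->.
Qed.

Lemma slot_fix p k t : p < k -> shrink_at R k (slot p true t) = slot p true t.
Proof.
elim: p k => [|p IHp] [|k] //; first by move=> _; exact: copyR_lam.
by rewrite ltnS shrink_atS slotS copyR_rho => /IHp ->.
Qed.

Lemma slot0 p b : (slot p b 0%:i01 == 0%:i01 :> I)%R = (p == 0).
Proof.
case: p => [|p]; first by case: b; rewrite /slot /= ?lam0; apply/eqP.
rewrite slotS; apply/negP => /eqP /(congr1 (fun t : I => t%:num%R)).
rewrite rhoE /=; have : (0 <= (slot p b 0%:i01)%:num)%R by exact: i01_ge0.
by move=> h0 e; lra.
Qed.

Lemma slot1 p b : (slot p b 1%:i01 == 1%:i01 :> I)%R = ~~ b.
Proof.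
elim: p => [|p IHp]; last first.
  by rewrite slotS -{2}[1%:i01%R]rho1 (inj_eq (@rho_inj R)).
case: b; last by rewrite /slot /= eqxx.
apply/negP => /eqP /(congr1 (fun t : I => t%:num%R)).
by rewrite lamE /=; lra.
Qed.

Lemma in_Phi_slot p b : in_Phi (slot p b).
Proof.
elim: p => [|p IHp]; last exact: in_Phi_compose IHp (in_Phi_rho R).
case: b; first exact: in_Phi_lam.
exact/in_F_Phi/in_F_id.
Qed.

Definition slot_Phi p b : Phi R := MkPhi (asboolT (in_Phi_slot p b)).

Lemma slot_disjoint p k b : p < k ->
  disjoint_images (slot_Phi p true) (slot_Phi k b).
Proof.
move=> pk; apply/disjoint_imagesP; left => /=.
elim: p k pk => [|p IHp] [|k] //; last by rewrite ltnS !slotS rho_le; exact: IHp.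
by move=> _; rewrite slotS -[slot 0 true _]/(lam _) -rho0 rho_le i01_ge0.
Qed.

Lemma fix_lam f : (forall t, f (lam t) = lam t) -> exists f1, f = copyR f1.
Proof.
move=> fl; have [f0 [f1 fE]] := half_split (fl 1%:i01%R).
exists f1; rewrite fE (_ : f0 = 1) ?copyL1 ?mul1g//.
apply: th_ext => t; apply: (@lam_inj R).
by have := fl t; rewrite fE thM copyL_lam copyR_lam.
Qed.

Lemma fix_rho f : (forall t, f (rho t) = rho t) -> exists f0, f = copyL f0.
Proof.
move=> fr; have [|f0 [f1 fE]] := @half_split _ f; first by rewrite -rho0 fr.
exists f0; rewrite fE (_ : f1 = 1) ?copyR1 ?mulg1//.
apply: th_ext => t; apply: (@rho_inj R).
by have := fr t; rewrite fE thM copyL_rho copyR_rho.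
Qed.

(** The midpoint is fixed, so [f] splits, and its right part fixes a left half pointwise. *)
Lemma fix_rholam f : (forall t, f (rho (lam t)) = rho (lam t)) ->
  exists f0 f1, f = copyL f0 * copyR (copyR f1).
Proof.
move=> frl; have [|f0 [f1 fE]] := @half_split _ f.
  by rewrite -rho0 -{1}lam0 frl lam0.
have [|f2 f2E] := @fix_lam f1; last by exists f0, f2; rewrite fE f2E.
move=> t; apply: (@rho_inj R).
by have := frl t; rewrite fE thM copyL_rho copyR_rho.
Qed.

End Slots.

(** * Homomorphisms into any group satisfying the relations of x and y *)

Section Inverse.
Variables (R : realType) (G : groupType).
Local Open Scope group_scope.
Local Notation F := (thompson R).
Local Notation slot := (@slot R).
Variables (x : nat -> G) (y : nat -> bool -> G).
Hypothesis xrel : thompson_rel x.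
Hypothesis xy_rel : forall p k b, p < k -> x p * y k b = y k.+1 b * x p.
Hypothesis yx_comm : forall p k, p < k -> commute (y p true) (x k).
Hypothesis yy_comm : forall p k b, p < k -> commute (y p true) (y k b).
Implicit Types (f : F).

(** A value exists because the a_k generate F, and is unique by faithfulness of the words. *)
Lemma gamma_exists : exists gamma : {multiplicative F -> G},
  forall k, gamma (shrink_at R k) = x k.
Proof.
have lift f : exists g, lifts x f g.
  elim: (th_generated f) => [|f1 f2 _ [g1 l1] _ [g2 l2]|f1 _ [g1 l1]|k].
  - by exists 1; exact: Lifts1.
  - by exists (g1 * g2); exact: liftsM.
  - by exists g1^-1; exact: lifts_inv.
  - by exists (x k); exact: lifts_gen.
pose gamma f := projT1 (cid (lift f)).
have gammaP f : lifts x f (gamma f) by rewrite /gamma; case: cid.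
have gammaM : {morph gamma : f g / f * g}.
  by move=> f g; apply: (lifts_uniq xrel (gammaP _)); exact: liftsM.
pose gM := isMultiplicative.Build _ _ gamma gammaM.
exists (HB.pack_for {multiplicative F -> G} gamma gM) => k.
by apply: (lifts_uniq xrel (gammaP _)); exact: lifts_gen.
Qed.

Variable gamma : {multiplicative F -> G}.
Hypothesis gammaX : forall k, gamma (shrink_at R k) = x k.

Lemma commute_gamma z (j : F -> F) :
    (forall f g, j (f * g) = j f * j g) ->
    (forall k, commute z (gamma (j (shrink_at R k)))) ->
  forall f, commute z (gamma (j f)).
Proof.
move=> jM zX f.
have j1 : j 1 = 1 by apply: (mulgI (j 1)); rewrite -jM !mulg1.
have jV g : j g^-1 = (j g)^-1 by apply: (mulgI (j g)); rewrite -jM !mulgV.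
elim: (th_generated f) => [|f1 f2 _ c1 _ c2|f1 _ c1|k]; last exact: zX.
- by rewrite j1 mult1; exact: commute1.
- by rewrite jM gmulfM; exact: commuteM.
- by rewrite jV multV; exact: commuteV.
Qed.

Lemma iter_copyRM j f g :
  iter j (@copyR R) (f * g) = iter j (@copyR R) f * iter j (@copyR R) g.
Proof. by elim: j => //= j ->; rewrite copyRM. Qed.

(** [comb_map R m] is a product of [m] generators, and each raises the index of [y] by one in
    passing. *)
Lemma comb_map_y j m b : gamma (iter j (@copyR R) (comb_map R m)) * y j.+1 b =
  y (j + m).+1 b * gamma (iter j (@copyR R) (comb_map R m)).
Proof.
elim: m j => [|m IHm] j.
  rewrite (_ : iter j _ _ = 1); last by elim: j => //= j ->; rewrite copyR1.
  by rewrite mult1 mul1g mulg1 addn0.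
rewrite [comb_map _ _]/= iter_copyRM gmulfM -iterSr -[iter j _ (shrink R)]/(shrink_at R j).
by rewrite gammaX -mulgA xy_rel// mulgA IHm addSnnS mulgA.
Qed.

(** By [copyL_shrink_at] the left copy of a generator is a quotient of two elements that both
    conjugate [y 1 b] to [y k.+3 b]. *)
Lemma copyL_central f b : commute (y 1 b) (gamma (copyL f)).
Proof.
move: f; apply: commute_gamma => [|k]; first exact: copyLM.
rewrite -(mulKg (shrink_at R k.+1 * comb_map R k.+1) (copyL _)) copyL_shrink_at.
have : gamma (comb_map R k.+1) * y 1 b = y k.+2 b * gamma (comb_map R k.+1).
  exact: comb_map_y 0 k.+1 b.
move: (comb_map R k.+1) => u cy; rewrite gmulfM multV !gmulfM !gammaX.
have e1 : x k * gamma u * y 1 b = y k.+3 b * (x k * gamma u).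
  by rewrite -mulgA cy mulgA xy_rel ?mulgA// leqW.
have e2 : x k.+1 * gamma u * y 1 b = y k.+3 b * (x k.+1 * gamma u).
  by rewrite -mulgA cy mulgA xy_rel ?mulgA.
exact: commute_div e2 e1.
Qed.

(** The pointwise stabilizers of [0,1/2], [0,1], [1/2,3/4] and [1/2,1] are products of scaled copies
    of F, one case each. *)
Lemma slot_stab m b f : m <= 1 -> (forall t, f (slot m b t) = slot m b t) ->
  y m b ^ gamma f = y m b.
Proof.
case: m b => [|[|m]] // [] _ fs; apply: conj_commute; apply: commute_sym.
- have [f1 ->] := fix_lam fs.
  by apply: commute_gamma => [|k]; [exact: copyRM|rewrite -shrink_atS gammaX; exact: yx_comm].
- by rewrite (_ : f = 1); [rewrite mult1; exact: commute1|exact: th_ext].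
- have [f0 [f1 ->]] := fix_rholam fs; rewrite gmulfM.
  apply: commuteM; first exact: copyL_central.
  apply: (commute_gamma (j := fun f => copyR (copyR f))) => [f' g|k].
    by rewrite !copyRM.
  by rewrite -!shrink_atS gammaX; exact: yx_comm.
- by have [f0 ->] := fix_rho fs; exact: copyL_central.
Qed.

(** Powers of [shrink] bring slot [p > 0] to slot 1, which leaves finitely many stabilizers to
    study; slot 0 contains the fixed point 0. *)
Lemma slot_reduce p b : exists2 f : F, forall t, f (slot p b t) = slot (minn p 1) b t
  & y p b ^ gamma f = y (minn p 1) b.
Proof.
case: p => [|p]; first by exists 1 => //; rewrite mult1 conjg1.
rewrite (minn_idPr _)//; elim: p => [|p [f fs fy]].
  by exists 1 => //; rewrite mult1 conjg1.
exists (shrink R * f) => [t|]; first by rewrite thM -[shrink R]/(shrink_at R 0) slot_shrink.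
rewrite gmulfM conjgM -fy; congr (_ ^ _).
rewrite -[shrink R]/(shrink_at R 0) gammaX conjgE.
by rewrite -xy_rel// mulKg.
Qed.

(** Elements of F fix 0 and 1, so they preserve [b] and whether [p] is 0. Both slots then reduce to
    the same one, where [slot_stab] applies. *)
Lemma slot_conj f p b p' b' : (forall t, f (slot p b t) = slot p' b' t) ->
  y p b ^ gamma f = y p' b'.
Proof.
move=> fs.
have pp : (p == 0) = (p' == 0).
  rewrite -(slot0 R p b) -(slot0 R p' b') -fs -[X in _ = (_ == X)](th_fix0 f).
  by rewrite (inj_eq (can_inj (thK f))).
have bb : b = b'.
  apply: negb_inj; rewrite -(slot1 R p b) -(slot1 R p' b') -fs.
  rewrite -[X in _ = (_ == X)](th_fix1 f).
  by rewrite (inj_eq (can_inj (thK f))).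
subst b'; have mm : minn p 1 = minn p' 1.
  by case: p p' pp {fs} => [|p] [|p'] //= _; rewrite !(minn_idPr _).
have [g gs gy] := slot_reduce p b; have [g' g's g'y] := slot_reduce p' b.
have : y (minn p 1) b ^ gamma (g^-1 * f * g') = y (minn p 1) b.
  apply: slot_stab => [|t]; first exact: geq_minr.
  by rewrite !thM -{1}gs thK fs g's mm.
rewrite -{1}gy -conjgM -gmulfM -mulgA mulVKg gmulfM conjgM mm -g'y.
exact: conjg_inj.
Qed.

Lemma beta_exists : exists beta : {multiplicative groupA R -> G},
  forall (h : Phi R) (f : F) p b, (forall t, h t = f (slot p b t)) ->
    beta (alpha h) = y p b ^ gamma f.
Proof.
have H (h : Phi R) : exists z, forall (f : F) p b,
    (forall t, h t = f (slot p b t)) -> z = y p b ^ gamma f.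
  have [f [p [b hE]]] := Phi_slot (Phi_in h); exists (y p b ^ gamma f) => f' p' b' hE'.
  (* Two expressions of [h] differ by [f * f'^-1], which carries one slot to the other. *)
  apply: (@conjg_inj _ (gamma f')^-1); rewrite conjgK -multV -conjgM -gmulfM.
  apply: slot_conj => t; rewrite thM.
  by rewrite -[f _]/((f \o slot p b) t) -hE hE' thK.
pose v h := projT1 (cid (H h)).
have vP (h : Phi R) (f : F) p b : (forall t, h t = f (slot p b t)) -> v h = y p b ^ gamma f.
  by rewrite /v; case: cid => z zP; exact: zP.
have vcomm (h1 h2 : Phi R) : (h1 1%:i01 <= h2 0%:i01)%R -> commute (v h1) (v h2).
  move=> /(Phi_slot2 (Phi_in h1) (Phi_in h2))[f [p1 [p2 [b [p12 e1 e2]]]]].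
  rewrite (@vP h1 f p1 true) ?(@vP h2 f p2 b) => [|t|t]; rewrite ?e1 ?e2//.
  exact/commute_conj/yy_comm.
have [|beta betaE] := @groupA_lift R G v.
  by move=> h1 h2 /disjoint_imagesP[/vcomm//|/vcomm/commute_sym].
by exists beta => h f p b hE; rewrite betaE; exact: vP.
Qed.

End Inverse.

(** * The diagram group *)

Section SemidirectFacts.
Variables (A F : groupType) (act : aut_action A F).
Local Open Scope group_scope.
Implicit Types (a b : A) (f g : F).

Lemma sd_inlM a b : sd_inl act (a * b) = sd_inl act a * sd_inl act b.
Proof. by apply: (congr1 (@SemiDirect A F act)); rewrite invg1 aact1 mulg1. Qed.

Lemma sd_inrM f g : sd_inr act (f * g) = sd_inr act f * sd_inr act g.
Proof. by apply: (congr1 (@SemiDirect A F act)); rewrite aact1g mulg1. Qed.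

Lemma sd_inlV a : sd_inl act a^-1 = (sd_inl act a)^-1.
Proof. by apply: (mulgI (sd_inl act a)); rewrite -sd_inlM !mulgV. Qed.

Lemma sd_inrV f : sd_inr act f^-1 = (sd_inr act f)^-1.
Proof. by apply: (mulgI (sd_inr act f)); rewrite -sd_inrM !mulgV. Qed.

Lemma sd_eta (z : semidirect act) :
  z = sd_inl act (sd_pair z).1 * sd_inr act (sd_pair z).2.
Proof.
case: z => -[a f]; apply: (congr1 (@SemiDirect A F act)).
by rewrite /= aact1g mulg1 mul1g.
Qed.

Lemma sd_inl_inr a f :
  sd_inr act f * sd_inl act (act a f) = sd_inl act a * sd_inr act f.
Proof. by rewrite -sd_conj -mulgA mulVKg. Qed.

End SemidirectFacts.

Lemma unit_seqP (s t : seq unit) : size s = size t -> s = t.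
Proof. by elim: s t => [|[] s IHs] [|[] t] //= [/IHs ->]. Qed.

(** * Edge labels and relations in the Squier complex of H1 *)

Section SquierH1.
Local Open Scope group_scope.
Local Notation edge := (sq_edge H1).
Local Notation X := (squier H1).

Lemma H1_is_path (s : seq (dedge H1)) : is_path s.
Proof.
case: s => // e s; rewrite /is_path /=; by elim: s e => //=.
Qed.

Definition H1_edge (b : bool) p r : edge :=
  @SqEdge H1 (nseq p tt, (b, true), nseq r tt) (H1_is_path _).

Definition width (b : bool) := if b then 2%N else 1%N.

Lemma sq_vert_size (v w : sq_vert H1) :
  size (sq_path v) = size (sq_path w) -> v = w.
Proof. by move=> /unit_seqP vw; apply: val_inj. Qed.

Lemma sq_edge_size (e e' : edge) :
    size (sq_triple e).1.1 = size (sq_triple e').1.1 ->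
    (sq_triple e).1.2 = (sq_triple e').1.2 ->
    size (sq_triple e).2 = size (sq_triple e').2 -> e = e'.
Proof.
case: e e' => -[[p f] q] h [[[p' f'] q'] h'] /= /unit_seqP pp ff /unit_seqP qq.
by apply: val_inj; rewrite /= pp ff qq.
Qed.

(** From a word of length k + 2 the first edge is x^k (x^2 = x); the base word has length 1. *)
Fixpoint merge_path n : seq edge :=
  if n is n'.+1 then
    if n' is k.+1 then H1_edge true k 0 :: merge_path n' else [::]
  else [::].

Definition tau (v : dvert X) : seq (dedge X) := merge_path (size (sq_path v)).

Lemma tauP v : dpath v (tau v) H1_x.
Proof.
rewrite /tau; move nE : (size _) => n; elim: n v nE => [|[|n] IHn] v nE.
- by have /andP[] := sq_vertP v; case: (sq_path v) nE.
- by apply/eqP/sq_vert_size.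
apply/andP; split.
  by apply/eqP/sq_vert_size; rewrite nE /= size_cat size_nseq addn2.
by apply: IHn; rewrite /= size_cat size_nseq addn1.
Qed.

Section EdgeValues.
Variables (K : groupType) (x : nat -> K) (y : nat -> bool -> K).

(** Only whether a letter follows the cell matters: [y p true] is y_p and [y p false] is z_p of the
    overview, and 1 is the value of a tree edge. *)
Definition cell_val (b : bool) p r : K :=
  if b then (if 0 < r then x p else 1) else y p (0 < r).

Definition edge_val (e : edge) : K :=
  let z := cell_val (sq_triple e).1.2.1 (size (sq_triple e).1.1)
             (size (sq_triple e).2) in
  if (sq_triple e).1.2.2 then z else z^-1.

Lemma edge_valV e : edge_val (sq_inv e) = (edge_val e)^-1.
Proof. by case: e => -[[p [b []]] q] h; rewrite /edge_val //= invgK. Qed.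

Hypothesis xrel : thompson_rel x.
Hypothesis xy_rel : forall p k b, p < k -> x p * y k b = y k.+1 b * x p.
Hypothesis yx_comm : forall p k, p < k -> commute (y p true) (x k).
Hypothesis yy_comm : forall p k b, p < k -> commute (y p true) (y k b).

(** The four pairs of kinds of cells give the four families of relations. The second cell starts at
    [p + s.+1] once the first has become one letter. *)
Lemma cell_val_square b b' p s r :
  cell_val b p (s + (width b' + r)) * cell_val b' (p + s.+1) r =
  cell_val b' (p + (width b + s)) r * cell_val b p (s + r.+1).
Proof.
have pk : p < p + s.+1 by lia.
have pos c : 0 < s + (width c + r) by case: c; rewrite /width; lia.
have -> : p + (width b + s) = if b then (p + s.+1).+1 else p + s.+1.
  by case: b; rewrite /width; lia.
rewrite /cell_val pos (pos false).
case: b b' => -[] /=.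
- by case: ifP; rewrite ?mulg1 ?mul1g// => _; exact: xrel.
- exact: xy_rel.
- by case: ifP; rewrite ?mulg1 ?mul1g// => _; exact: yx_comm.
- exact: yy_comm.
Qed.

Lemma edge_val_bdry (c : sq_face H1) : \prod_(e <- sq_bdry c) edge_val e = 1.
Proof.
case: c => p [b sb] q [b' sb'] r h.
have := cell_val_square b b' (size p) (size q) (size r).
rewrite /sq_bdry !big_cons big_nil mulg1 !edge_valV /edge_val /= {h} !size_cat.
have -> : size (H1_top (b, sb)) = if sb then width b else 1%N by case: b sb => -[].
have -> : size (H1_bot (b, sb)) = if sb then 1%N else width b by case: b sb => -[].
have -> : size (H1_top (b', sb')) = if sb' then width b' else 1%N by case: b' sb' => -[].
have -> : size (H1_bot (b', sb')) = if sb' then 1%N else width b' by case: b' sb' => -[].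
move=> sq; rewrite mulgA -invgM; apply/eqP; rewrite divg_eq1; apply/eqP.
(* Reversing a cell exchanges opposite sides of the square, so each choice of signs rearranges the
   same relation. *)
case: sb sb' sq => -[] sq; first exact: sq.
- exact/esym/(mul_eq_div sq).
- exact/(mul_eq_div (esym sq)).
- by rewrite -!invgM; congr _^-1; apply: esym.
Qed.

End EdgeValues.

Section DiagramGroup.
Local Notation G := (diagram_group H1_x).

Definition gen (b : bool) p r : G := based_edge tauP (H1_edge b p r).

Lemma gen_square b b' p s r :
  gen b p (s + (width b' + r)) * gen b' (p + s.+1) r =
  gen b' (p + (width b + s)) r * gen b p (s + r.+1).
Proof.
pose c := @SqFace H1 (nseq p tt) (b, true) (nseq s tt) (b', true) (nseq r tt)
  (H1_is_path _).
have := @based_bdry X H1_x tau tauP c.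
rewrite /= /sq_bdry !big_cons big_nil mulg1.
have eV (e : edge) :
    based_edge tauP (sq_inv e : dedge X) = (based_edge tauP (e : dedge X))^-1.
  exact: (@based_edgeV X H1_x tau tauP e).
rewrite !eV mulgA -invgM => /divg1_eq; rewrite /gen => sq.
have top_size d : size (H1_top (d, true)) = width d by case: d.
have bot_size d : size (H1_bot (d, true)) = 1%N by case: d.
have -> : H1_edge b p (s + (width b' + r)) = @SqEdge H1 (_, _, _) (sq_side1 c).
  by apply: sq_edge_size; rewrite //= !size_cat !size_nseq top_size.
have -> : H1_edge b' (p + s.+1) r = @SqEdge H1 (_, _, _) (sq_side2 c).
  by apply: sq_edge_size; rewrite //= !size_cat !size_nseq bot_size.
have -> : H1_edge b' (p + (width b + s)) r = @SqEdge H1 (_, _, _) (sq_side4 c).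
  by apply: sq_edge_size; rewrite //= !size_cat !size_nseq top_size.
have -> : H1_edge b p (s + r.+1) = @SqEdge H1 (_, _, _) (sq_side3 c).
  by apply: sq_edge_size; rewrite //= !size_cat !size_nseq bot_size.
exact: sq.
Qed.

Lemma gen_tree p : gen true p 0 = 1.
Proof.
apply: (@based_tree_edge X H1_x tau tauP); rewrite /tau /=.
by rewrite !size_cat !size_nseq /= addn2 addn1.
Qed.

Definition gen_x p : G := gen true p 1.
Definition gen_y p (b : bool) : G := gen false p b.

Lemma genE b p r : gen b p r = cell_val gen_x gen_y b p r.
Proof.
have stab b' q s : gen b' q s.+1 = gen b' q 1.
  elim: s => // s <-.
  have := gen_square b' true q s 0.
  (* In this square the second cell merges the last two letters, a tree edge; this shortens the
     right context by one. *)
  by rewrite !gen_tree mulg1 mul1g /width !addnS !addn0.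
by case: r b => [|r] []; rewrite /cell_val /gen_x /gen_y ?gen_tree//= stab.
Qed.

Lemma based_edgeE (e : edge) : based_edge tauP (e : dedge X) = edge_val gen_x gen_y e.
Proof.
have pos p b r : based_edge tauP (H1_edge b p r : dedge X) = cell_val gen_x gen_y b p r.
  exact: genE.
case: e => -[[p [b s]] q] h; rewrite /edge_val /= -pos.
have e1 : H1_edge b (size p) (size q) = @SqEdge H1 (p, (b, true), q) (H1_is_path _).
  by apply: sq_edge_size; rewrite //= size_nseq.
case: s h => h.
  by congr based_edge; apply: sq_edge_size; rewrite //= size_nseq.
have := @based_edgeV X H1_x tau tauP (H1_edge b (size p) (size q)).
move=> <-; congr based_edge.
by apply: sq_edge_size; rewrite //= size_nseq.
Qed.

Lemma gen_rel b b' p k r : p < k ->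
  cell_val gen_x gen_y b p 1 * cell_val gen_x gen_y b' k r =
  cell_val gen_x gen_y b' (if b then k.+1 else k) r * cell_val gen_x gen_y b p 1.
Proof.
move=> pk; have := gen_square b b' p (k - p.+1) r; rewrite !genE.
have pos c s : 0 < s -> cell_val gen_x gen_y c p s = cell_val gen_x gen_y c p 1.
  by move=> s0; rewrite /cell_val s0.
rewrite !(pos b); [|by rewrite /width; case: (b'); lia..].
rewrite (_ : p + (k - p.+1).+1 = k); last by lia.
by rewrite (_ : p + (width b + _) = if b then k.+1 else k)//; rewrite /width; case: (b); lia.
Qed.

Lemma gen_x_rel : thompson_rel gen_x.
Proof. by move=> p k pk; exact: (gen_rel true true 1 pk). Qed.

Lemma gen_xy_rel p k b : p < k -> gen_x p * gen_y k b = gen_y k.+1 b * gen_x p.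
Proof. by move=> pk; have := gen_rel true false b pk; case: b. Qed.

Lemma gen_yx_comm p k : p < k -> commute (gen_y p true) (gen_x k).
Proof. by move=> pk; exact: (gen_rel false true 1 pk). Qed.

Lemma gen_yy_comm p k b : p < k -> commute (gen_y p true) (gen_y k b).
Proof. by move=> pk; have := gen_rel false false b pk; case: b. Qed.

End DiagramGroup.

(** The paths that close up an edge consist of tree edges, whose values are 1. *)
Lemma edge_val_class (K : groupType) (v : edge -> K)
    (phi : {multiplicative diagram_group H1_x -> K}) :
    (forall l : @loop X H1_x, phi (homotopy_class l) = \prod_(e <- loop_seq l) v e) ->
    (forall e, v (sq_inv e) = (v e)^-1) -> (forall p, v (H1_edge true p 0) = 1) ->
  forall e, phi (based_edge tauP (e : dedge X)) = v e.
Proof.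
move=> phiE vV vt e.
have tau1 n : \prod_(e <- merge_path n) v e = 1.
  elim: n => [|[|n] IHn]; rewrite ?big_nil//.
  by rewrite [merge_path _]/= big_cons vt mul1g.
have invE s : \prod_(e <- path_inv (X := X) s) v e = (\prod_(e <- s) v e)^-1.
  elim: s => [|e' s IHs]; first by rewrite !big_nil invg1.
  rewrite -cat1s path_inv_cat !big_cat IHs /= big_seq1 invgM; congr (_ * _).
  by rewrite /path_inv /= big_seq1; exact: vV.
have [l -> lE] := based_edge_class tauP (e : dedge X).
by rewrite phiE lE /tau big_cat /= big_cons invE !tau1 invg1 mul1g mulg1.
Qed.

End SquierH1.

(** * The two mutually inverse homomorphisms *)

Section Isomorphism.
Variable R : realType.
Local Notation F := (thompson R).
Local Notation A := (groupA R).
Local Open Scope group_scope.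
Variable act : aut_action A F.
Hypothesis actE : forall (h : Phi R) (g : F), act (alpha h) g = alpha (Phi_mul h g).
Local Notation S := (semidirect act).

Definition sd_x p : S := sd_inr act (shrink_at R p).
Definition sd_y p b : S := sd_inl act (alpha (slot_Phi R p b)).

Lemma act_slot (f : F) p b p' b' : (forall t, f (slot p b t) = slot p' b' t) ->
  act (alpha (slot_Phi R p b)) f = alpha (slot_Phi R p' b').
Proof. by move=> fs; rewrite actE; congr alpha; apply/val_inj/funext. Qed.

Lemma sd_x_rel : thompson_rel sd_x.
Proof. by move=> p k pk; rewrite /sd_x -!sd_inrM shrink_at_rel. Qed.

Lemma sd_xy_rel p k b : p < k -> sd_x p * sd_y k b = sd_y k.+1 b * sd_x p.
Proof.
move=> pk; rewrite /sd_y -(@act_slot (shrink_at R p) k.+1 b) ?sd_inl_inr// => t.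
exact: slot_shrink.
Qed.

Lemma sd_yx_comm p k : p < k -> commute (sd_y p true) (sd_x k).
Proof.
move=> pk; rewrite /commute -sd_inl_inr (@act_slot (shrink_at R k) p true p true)// => t.
exact: slot_fix.
Qed.

Lemma sd_yy_comm p k b : p < k -> commute (sd_y p true) (sd_y k b).
Proof.
move=> pk; rewrite /commute /sd_y -!sd_inlM.
by congr sd_inl; apply/alpha_commute/slot_disjoint.
Qed.

Lemma diagram_iso : exists phi : {multiplicative diagram_group H1_x -> S}, bijective phi.
Proof.
have [gamma gammaE] := gamma_exists R gen_x_rel.
have [beta betaE] := beta_exists gen_xy_rel gen_yx_comm gen_yy_comm gammaE.
have [phi phiE] := pi1_lift (X := squier H1) H1_x (edge_valV sd_x sd_y)
  (edge_val_bdry sd_x_rel sd_xy_rel sd_yx_comm sd_yy_comm).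
exists phi.
have phi_edge e : phi (based_edge tauP (e : dedge (squier H1))) = edge_val sd_x sd_y e.
  by apply: edge_val_class phiE (edge_valV _ _) _ e.
have beta_act a f : beta (act a f) = beta a ^ gamma f.
  elim/groupA_ind: a => [|a b IHa IHb|a IHa|h].
  - by rewrite aact1g mult1 conj1g.
  - by rewrite aact_mul !gmulfM IHa IHb conjMg.
  - have actV : act a^-1 f = (act a f)^-1.
      by apply: (mulgI (act a f)); rewrite -aact_mul !mulgV aact1g.
    by rewrite actV !multV IHa conjVg.
  - have [g [p [b hE]]] := Phi_slot (Phi_in h).
    have hE' t : h t = g (slot p b t) by rewrite hE.
    rewrite actE (betaE h g p b)// (betaE _ (g * f) p b) => [|t]; last by rewrite /= hE'.
    by rewrite gmulfM conjgM.
(* The pair (a, f) stands for a product; [beta_act] makes this formula multiplicative. *)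
pose psi (z : S) := beta (sd_pair z).1 * gamma (sd_pair z).2.
have psiM : {morph psi : z w / z * w}.
  move=> [[a f]] [[b g]]; rewrite /psi /= !gmulfM beta_act multV.
  by rewrite conjgE invgK !mulgA mulgVK.
pose psi' : {multiplicative S -> diagram_group H1_x} :=
  HB.pack_for {multiplicative S -> diagram_group H1_x} psi
    (isMultiplicative.Build _ _ psi psiM).
have psi_edge e : psi (edge_val sd_x sd_y e) = edge_val gen_x gen_y e.
  have psi_cell b p r : psi (cell_val sd_x sd_y b p r) = cell_val gen_x gen_y b p r.
    have psi_y c : psi (sd_y p c) = gen_y p c.
      rewrite /psi /= mult1 mulg1 (betaE _ 1 p c)//.
      by rewrite mult1 conjg1.
    have psi_x : psi (sd_x p) = gen_x p by rewrite /psi /= mult1 mul1g gammaE.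
    rewrite /cell_val; case: b; last exact: psi_y.
    by case: ifP => _; [exact: psi_x|exact: (mult1 psi')].
  rewrite /edge_val; case: ifP => _; first exact: psi_cell.
  by rewrite -psi_cell; exact: (multV psi').
(* One composite is the identity on based edges, which generate the diagram group. *)
exists psi => [g|z].
  rewrite -[g]qreprK -[qclass _]/(homotopy_class _) phiE.
  rewrite -[LHS]/(psi' _) mult_prod (class_prod tauP)//.
  by apply: eq_bigr => e _; rewrite based_edgeE; exact: psi_edge.
(* The other composite is checked on the generators of F and then on the [alpha h], written as a
   slot followed by an element of F. *)
have phi_gamma f : phi (gamma f) = sd_inr act f.
  elim: (th_generated f) => [|f1 f2 _ IH1 _ IH2|f1 _ IH1|k].
  - by rewrite !mult1.
  - by rewrite !gmulfM IH1 IH2 sd_inrM.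
  - by rewrite !multV IH1 sd_inrV.
  - by rewrite gammaE phi_edge /edge_val /= size_nseq.
rewrite [RHS]sd_eta /psi gmulfM phi_gamma; congr (_ * _).
elim/groupA_ind: (sd_pair z).1 => [|a b IHa IHb|a IHa|h].
- by rewrite !mult1.
- by rewrite !gmulfM IHa IHb sd_inlM.
- by rewrite !multV IHa sd_inlV.
have [g [p [b hE]]] := Phi_slot (Phi_in h).
have hE' t : h t = g (slot p b t) by rewrite hE.
rewrite (betaE h g p b)// conjgE !gmulfM multV phi_gamma phi_edge.
rewrite /edge_val /= !size_nseq /cell_val lt0b mulgA sd_conj actE.
by congr (sd_inl act (alpha _)); apply/val_inj/funext => t /=; rewrite hE'.
Qed.

End Isomorphism.

Theorem theorem5p6 (R : realType) :
  exists act : aut_action (groupA R) (thompson R),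
    (forall (h : Phi R) (g : thompson R),
       act (alpha h) g = alpha (Phi_mul h g)) /\
    exists phi : {multiplicative diagram_group H1_x -> semidirect act},
      bijective phi.
Proof.
have [act actE] := act_exists R.
by exists act; split; [exact: actE|exact: diagram_iso].
Qed.
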